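(* Let $\mathbf U$ be a unipotent group over $\mathbf k$ of nilpotency class $n$, with Lie algebra $\mathfrak u$. Let $A=\sum_{j=m}^\infty A_j\,t^j\in\mathfrak u_F$ be a connection with $A_m\ne0$. (i) If $m>-1$, then there exists $x\in\mathbf U(\mathcal O)$ such that $x\equiv1\pmod{t^{m+1}}$ and $x\cdot A=0$. (ii) If $m\le-1$, then the gauge equivalence class of $A$ is determined by $A_j$ for $m\le j<n(|m|-1)$. More precisely, suppose that $B\in\mathfrak u_F$ is another connection with $B\equiv A\pmod{t^k}$ for some integer $k\ge n(|m|-1)$. Then there exists $x\in\mathbf U(\mathcal O)$ with $x\equiv1\pmod{t^{k-n|m|+n+1}}$ such that $x\cdot A=B$.
   Context: $\mathbf k$ is an algebraically closed field of characteristic $0$; $\mathcal O=\mathbf k[[t]]$, $F=\mathbf k((t))$; $\mathfrak u_F=\mathfrak u\otimes_{\mathbf k}F$. A connection is an element of $\mathfrak u_F$. The gauge action of $\mathbf U(F)$ on $\mathfrak u_F$ is $x\cdot A=\mathrm{Ad}(x)A+\frac{dx}{dt}x^{-1}$ (computed in any faithful representation). For connections, $\pmod{t^k}$ means modulo $t^k\mathfrak u_{\mathcal O}$; for $x\in\mathbf U(\mathcal O)$, $x\equiv1\pmod{t^k}$ means that $x$ maps to $1$ in $\mathbf U(\mathcal O/t^k\mathcal O)$. The nilpotency class is the length of the upper central series, normalized so that commutative unipotent groups have nilpotency class $0$, and a noncommutative $\mathbf U$ has class one more than $\mathbf U/Z_{\mathbf U}$, where $Z_{\mathbf U}$ is the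 center. *)

(* Defs.v *)
From HB Require Import structures.
From mathcomp Require Import all_boot all_order all_algebra.
From mathcomp Require Import boolp classical_sets functions cardinality fsbigop.
From mathcomp Require Import mpoly.
From mathcomp Require Import zify.

Set Implicit Arguments.
Unset Strict Implicit.
Unset Printing Implicit Defensive.

Import Order.TTheory GRing.Theory Num.Theory.

Local Open Scope ring_scope.

Lemma int_split (p j : int) : p <= j -> exists n : nat, j = p + n%:Z.
Proof. by move=> pj; exists (absz (j - p)); lia. Qed.

Section Laurent.
Variable k : fieldType.

Definition bounded_below (f : int -> k) : Prop :=
  exists p : int, forall j, j < p -> f j = 0.

(** The field k((t)); [f j] is the coefficient of t^j. *)
Record laurent : Type := Laurent {
  lcoef :> int -> k;
  lcoefP : bounded_below lcoef }.

HB.instance Definition _ := gen_eqMixin laurent.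
HB.instance Definition _ := gen_choiceMixin laurent.

Lemma laurentP (f g : laurent) : (forall j, f j = g j) -> f = g.
Proof.
case: f g => [f hf] [g hg] /= fg.
have e : f = g by apply: functional_extensionality_dep.
by case: g / e hg fg => hg _; congr Laurent; exact: Prop_irrelevance.
Qed.

Fact lconst_subproof (c : k) :
  bounded_below (fun j => if j == 0 then c else 0).
Proof. by exists 0 => j j0; rewrite lt_eqF. Qed.
Definition lconst (c : k) : laurent := Laurent (lconst_subproof c).

Fact lvar_subproof : bounded_below (fun j => (j == 1)%:R).
Proof. by exists 1 => j j1; rewrite lt_eqF. Qed.
Definition lvar : laurent := Laurent lvar_subproof.

Fact ladd_subproof (f g : laurent) : bounded_below (fun j => f j + g j).
Proof.
have [[p hp] [q hq]] := (lcoefP f, lcoefP g).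
exists (Order.min p q) => j; rewrite lt_min => /andP[jp jq].
by rewrite hp // hq // addr0.
Qed.
Definition ladd f g := Laurent (ladd_subproof f g).

Fact lopp_subproof (f : laurent) : bounded_below (fun j => - f j).
Proof. by have [p hp] := lcoefP f; exists p => j jp; rewrite hp // oppr0. Qed.
Definition lopp f := Laurent (lopp_subproof f).

Fact lscale_subproof (c : k) (f : laurent) : bounded_below (fun j => c * f j).
Proof. by have [p hp] := lcoefP f; exists p => j jp; rewrite hp // mulr0. Qed.
Definition lscale c f := Laurent (lscale_subproof c f).

Fact lderiv_subproof (f : laurent) : bounded_below (fun j => f (j + 1) *~ (j + 1)).
Proof.
have [p hp] := lcoefP f; exists (p - 1) => j jp.
by rewrite hp ?mul0rz // -ltrBrDr.
Qed.
(** d/dt *)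
Definition lderiv f := Laurent (lderiv_subproof f).

(** The sum has finite support. *)
Definition conv (f g : int -> k) (j : int) : k :=
  \sum_(i \in [set: int]%classic) f i * g (j - i).

Lemma conv_shift (f g : int -> k) (p q : int) (n : nat) :
  (forall j, j < p -> f j = 0) -> (forall j, j < q -> g j = 0) ->
  conv f g (p + q + n%:Z) = \sum_(i < n.+1) f (p + i%:Z) * g (q + (n - i)%:Z).
Proof.
move=> hp hq; rewrite /conv.
rewrite (@fsbigE _ _ _ _ _ [seq p + i%:Z | i <- iota 0 n.+1]); first last.
- move=> i _ hi; have [/hp ->|pi] := ltP i p; first by rewrite mul0r.
  rewrite hq ?mulr0 //; case: ltP => // h; case/mapP: hi.
  by exists (absz (i - p)); [rewrite mem_iota|]; lia.
- by [].
- by rewrite map_inj_uniq ?iota_uniq // => a b /addrI [].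
rewrite big_map -[iota 0 n.+1]/(index_iota 0 n.+1) big_mkord.
apply: eq_big => [i|i _]; first by rewrite in_setT.
by congr (_ * g _); have := ltn_ord i; lia.
Qed.

Lemma conv_low (f g : int -> k) (p q j : int) :
  (forall j, j < p -> f j = 0) -> (forall j, j < q -> g j = 0) ->
  j < p + q -> conv f g j = 0.
Proof.
move=> hp hq jpq; rewrite /conv fsbig1 // => i _.
have [/hp ->|pi] := ltP i p; first by rewrite mul0r.
by rewrite hq ?mulr0 //; lia.
Qed.

Fact lmul_subproof (f g : laurent) : bounded_below (conv f g).
Proof.
have [[p hp] [q hq]] := (lcoefP f, lcoefP g).
by exists (p + q) => j; exact: conv_low hp hq.
Qed.
Definition lmul f g := Laurent (lmul_subproof f g).

Let trunc (f : int -> k) (p : int) (M : nat) : {poly k} :=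
  \poly_(i < M) f (p + i%:Z).

Let conv_trunc (f g : int -> k) (p q : int) (M n : nat) : (n < M)%N ->
  (forall j, j < p -> f j = 0) -> (forall j, j < q -> g j = 0) ->
  conv f g (p + q + n%:Z) = (trunc f p M * trunc g q M)`_n.
Proof.
move=> nM hp hq; rewrite conv_shift // coefM; apply: eq_bigr => i _.
have := ltn_ord i; rewrite ltnS => ilen.
by rewrite !coef_poly (leq_ltn_trans ilen nM) (leq_ltn_trans (leq_subr _ _) nM).
Qed.

Let trunc_conv_l (f g : int -> k) (p q : int) (M n : nat) (s : {poly k}) :
  (n < M)%N ->
  (forall j, j < p -> f j = 0) -> (forall j, j < q -> g j = 0) ->
  (trunc (conv f g) (p + q) M * s)`_n = (trunc f p M * trunc g q M * s)`_n.
Proof.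
move=> nM hp hq; rewrite !coefM; apply: eq_bigr => i _; congr (_ * _).
have iM : (i < M)%N by apply: leq_ltn_trans nM; rewrite -ltnS.
by rewrite coef_poly iM (conv_trunc iM).
Qed.

Fact laddA : associative ladd.
Proof. by move=> f g h; apply: laurentP => j /=; rewrite addrA. Qed.
Fact laddC : commutative ladd.
Proof. by move=> f g; apply: laurentP => j /=; rewrite addrC. Qed.
Fact ladd0 : left_id (lconst 0) ladd.
Proof. by move=> f; apply: laurentP => j /=; rewrite if_same add0r. Qed.
Fact laddN : left_inverse (lconst 0) lopp ladd.
Proof. by move=> f; apply: laurentP => j /=; rewrite if_same addNr. Qed.

HB.instance Definition _ := GRing.isZmodule.Build laurent laddA laddC ladd0 laddN.

Fact lmulC : commutative lmul.
Proof.
move=> f g; apply: laurentP => j /=.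
have [[p hp] [q hq]] := (lcoefP f, lcoefP g).
have [jpq|/int_split[n ->]] := ltP j (p + q).
  by rewrite (conv_low hp hq) // (conv_low hq hp) // addrC.
by rewrite (conv_trunc (ltnSn _)) // mulrC [p + q]addrC (conv_trunc (ltnSn _)).
Qed.

Fact lmulA : associative lmul.
Proof.
move=> f g h; apply: laurentP => j.
rewrite [lmul f _]lmulC.
have [[[p hp] [q hq]] [r hr]] := (lcoefP f, lcoefP g, lcoefP h) => /=.
have hgh i : i < q + r -> conv g h i = 0 by exact: conv_low.
have hfg i : i < p + q -> conv f g i = 0 by exact: conv_low.
have [jpq|/int_split[n ->]] := ltP j (p + q + r).
  rewrite (conv_low hgh hp) ?(conv_low hfg hr) //; lia.
rewrite [in RHS](conv_trunc (ltnSn _)) //.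
have -> : p + q + r = q + r + p by lia.
rewrite (conv_trunc (ltnSn _)) // !trunc_conv_l //.
by rewrite mulrC mulrA.
Qed.

Fact lmul1 : left_id (lconst 1) lmul.
Proof.
move=> f; apply: laurentP => j /=; have [p hp] := lcoefP f.
have h1 i : i < 0 -> lconst 1 i = 0 by move=> i0 /=; rewrite lt_eqF.
have [jp|/int_split[n ->]] := ltP j p; first by rewrite (conv_low h1 hp) ?hp ?add0r.
rewrite -{1}[p]add0r (conv_shift _ h1 hp) big_ord_recl /= big1 => [|i _]; last first.
  by rewrite mul0r.
by rewrite mul1r addr0 subn0.
Qed.

Fact lmulDl : left_distributive lmul ladd.
Proof.
move=> f g h; apply: laurentP => j /=.
have [[[p0 hp0] [q0 hq0]] [r hr]] := (lcoefP f, lcoefP g, lcoefP h).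
pose p := Order.min p0 q0.
have hp i : i < p -> f i = 0 by rewrite lt_min => /andP[/hp0].
have hq i : i < p -> g i = 0 by rewrite lt_min => /andP[_ /hq0].
have hpq i : i < p -> ladd f g i = 0 by move=> ip /=; rewrite hp // hq // addr0.
have [jp|/int_split[n ->]] := ltP j (p + r).
  by rewrite (conv_low hp hr) // (conv_low hq hr) // (conv_low hpq hr) // addr0.
rewrite (conv_shift _ hp hr) (conv_shift _ hq hr) (conv_shift _ hpq hr).
by rewrite -big_split /=; apply: eq_bigr => i _; rewrite mulrDl.
Qed.

Fact lone_neq0 : lconst 1 != 0.
Proof.
by apply/eqP => /(congr1 (fun f : laurent => f 0)) /= /eqP; rewrite oner_eq0.
Qed.

HB.instance Definition _ :=
  GRing.Zmodule_isComNzRing.Build laurent lmulA lmulC lmul1 lmulDl lone_neq0.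

Section Inverse.
Variable a : nat -> k.
Fixpoint inv_pref n : seq k :=
  if n is n'.+1 then
    rcons (inv_pref n')
      (- ((a 0)^-1 * \sum_(i < n) a i.+1 * (inv_pref n')`_(n' - i)))
  else [:: (a 0)^-1].
Definition inv_coef n := (inv_pref n)`_n.

Let size_pref n : size (inv_pref n) = n.+1.
Proof. by elim: n => //= n IHn; rewrite size_rcons IHn. Qed.

Let nth_pref n m : (m <= n)%N -> (inv_pref n)`_m = inv_coef m.
Proof.
elim: n => [|n IHn]; first by rewrite leqn0 => /eqP ->.
rewrite leq_eqVlt => /predU1P[-> //|]; rewrite ltnS => mn.
by rewrite /= nth_rcons size_pref ltnS mn IHn.
Qed.

Lemma inv_coefP n : a 0 != 0 ->
  \sum_(i < n.+1) a i * inv_coef (n - i) = (n == 0)%:R.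
Proof.
move=> a0; case: n => [|n]; first by rewrite big_ord1 /inv_coef /= divff.
rewrite big_ord_recl /= /inv_coef /= nth_rcons size_pref ltnn eqxx.
rewrite mulrN mulrA divff // mul1r.
apply/eqP; rewrite addrC subr_eq0; apply/eqP; apply: eq_bigr => i _.
by rewrite /bump add1n subSS !nth_pref ?leq_subr.
Qed.
End Inverse.

Lemma laurent_order (f : laurent) : f != 0 ->
  exists2 p : int, (forall j, j < p -> f j = 0) & f p != 0.
Proof.
move=> f0; have [p hp] := lcoefP f.
have ex : exists n : nat, f (p + n%:Z) != 0.
  apply: contrapT => nex; case/eqP: f0; apply: laurentP => j /=.
  rewrite if_same; have [/hp //|/int_split[n ->]] := ltP j p.
  by apply: contrapT => /eqP fn; apply: nex; exists n.
case: (ex_minnP ex) => n fn min_n; exists (p + n%:Z) => // j jpn.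
have [/hp //|/int_split[i ji]] := ltP j p; apply/eqP; apply: contraT => fj.
by move: jpn; rewrite ji ltrD2l ltz_nat ltnNge min_n // -ji.
Qed.

Lemma laurent_inv_ex (f : laurent) : f != 0 -> exists g : laurent, g * f = 1.
Proof.
move=> /laurent_order [p hp fp].
pose b := inv_coef (fun n => f (p + n%:Z)).
pose g (j : int) : k := if j < - p then 0 else b (absz (j + p)).
have hg j : j < - p -> g j = 0 by rewrite /g => ->.
have bg : bounded_below g by exists (- p).
exists (Laurent bg); rewrite mulrC; apply: laurentP => j /=.
have [j0|/int_split[n ->]] := ltP j 0.
  by rewrite (conv_low hp hg) ?subrr // lt_eqF.
rewrite -{1}(subrr p) (conv_shift _ hp hg) add0r -[0 in RHS]/(0%:Z) eqz_nat.
transitivity ((n == 0)%:R : k); last by case: eqP.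
rewrite -(inv_coefP _ (a := fun n => f (p + n%:Z))) ?addr0 //.
apply: eq_bigr => i _; congr (_ * _); rewrite /g ifF ?/b; first last.
  by apply/negbTE; rewrite -leNgt lerDl.
by congr inv_coef; lia.
Qed.

Definition linv (f : laurent) : laurent :=
  if pselect (exists g : laurent, g * f = 1) is left ex then projT1 (cid ex)
  else 0.

Fact lmulVf (f : laurent) : f != 0 -> linv f * f = 1.
Proof.
move=> /laurent_inv_ex ex; rewrite /linv; case: pselect => // ex'.
by case: (cid ex').
Qed.

Fact linv0 : linv 0 = 0.
Proof.
rewrite /linv; case: pselect => // ex; exfalso.
by case: ex => g /esym/eqP; rewrite mulr0 oner_eq0.
Qed.

HB.instance Definition _ := GRing.ComNzRing_isField.Build laurent lmulVf linv0.

Fact lscaleA a b f : lscale a (lscale b f) = lscale (a * b) f.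
Proof. by apply: laurentP => j /=; rewrite mulrA. Qed.
Fact lscale1 : left_id 1 lscale.
Proof. by move=> f; apply: laurentP => j /=; rewrite mul1r. Qed.
Fact lscaleDr : right_distributive lscale +%R.
Proof. by move=> a f g; apply: laurentP => j /=; rewrite mulrDr. Qed.
Fact lscaleDl f : {morph lscale^~ f : a b / a + b}.
Proof. by move=> a b; apply: laurentP => j /=; rewrite mulrDl. Qed.

HB.instance Definition _ :=
  GRing.Zmodule_isLmodule.Build k laurent lscaleA lscale1 lscaleDr lscaleDl.

Fact lscaleAl (a : k) (f g : laurent) : a *: (f * g) = (a *: f) * g.
Proof.
apply: laurentP => j /=; have [[p hp] [q hq]] := (lcoefP f, lcoefP g).
have hap i : i < p -> lscale a f i = 0 by move=> ip /=; rewrite hp // mulr0.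
have [jp|/int_split[n ->]] := ltP j (p + q).
  by rewrite (conv_low hp hq) // (conv_low hap hq) // mulr0.
rewrite (conv_shift _ hp hq) (conv_shift _ hap hq) mulr_sumr.
by apply: eq_bigr => i _; rewrite mulrA.
Qed.

HB.instance Definition _ := GRing.Lmodule_isLalgebra.Build k laurent lscaleAl.
HB.instance Definition _ := GRing.Lalgebra_isComAlgebra.Build k laurent.

Definition integral : {pred laurent} :=
  fun f => `[< forall j : int, j < 0 -> f j = 0 >].

Lemma integralP (f : laurent) :
  reflect (forall j : int, j < 0 -> f j = 0) (f \in integral).
Proof. exact: asboolP. Qed.

Fact integral_subalg : GRing.subsemialg_closed integral.
Proof.
split; first by apply/integralP => j j0 /=; rewrite lt_eqF.
- split; first by apply/integralP => j j0 /=; rewrite if_same.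
  move=> f g /integralP hf /integralP hg; apply/integralP => j j0 /=.
  by rewrite hf // hg // addr0.
- by move=> a f /integralP hf; apply/integralP => j j0 /=; rewrite hf // mulr0.
move=> f g /integralP hf /integralP hg; apply/integralP => j j0.
exact: (conv_low hf hg).
Qed.

(** k[[t]], as the subalgebra of k((t)) of the series without negative
    powers of t. *)
Record powser : Type := Powser {
  psval :> laurent;
  psvalP : psval \in integral }.

HB.instance Definition _ := [isSub for psval].
HB.instance Definition _ := [Choice of powser by <:].

HB.instance Definition _ :=
  GRing.SubChoice_isSubComNzRing.Build laurent integral powser
    (GRing.subsemialg_closedBM integral_subalg).
HB.instance Definition _ :=
  GRing.SubZmodule_isSubLmodule.Build k laurent integral powser
    (GRing.subsemialg_closedZ integral_subalg).
HB.instance Definition _ :=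
  GRing.SubNzRing_SubLmodule_isSubLalgebra.Build k laurent integral powser.
HB.instance Definition _ :=
  GRing.SubLalgebra_isSubAlgebra.Build k laurent integral powser.

Lemma lvarM (f : laurent) (j : int) : (lvar * f) j = f (j - 1).
Proof.
have [p hp] := lcoefP f.
have h1 i : i < 1 -> lvar i = 0 by move=> i0 /=; rewrite lt_eqF.
have [jp|/int_split[n ->]] := ltP j (1 + p).
  by rewrite [LHS](conv_low h1 hp) // hp //; lia.
rewrite [LHS](conv_shift _ h1 hp) big_ord_recl /= big1 => [|i _]; last first.
  by rewrite mul0r.
by rewrite mul1r addr0 subn0; congr (f _); lia.
Qed.

Lemma lvar_neq0 : lvar != 0.
Proof.
by apply/eqP => /(congr1 (fun f : laurent => f 1)) /= /eqP; rewrite oner_eq0.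
Qed.

(** [lvar ^ e] is t^e for every integer e. *)
Lemma lvarXM (e : int) (f : laurent) (j : int) :
  (lvar ^ e * f) j = f (j - e).
Proof.
have natX (n : nat) (h : laurent) i : (lvar ^+ n * h) i = h (i - n%:Z).
  elim: n h i => [|n IHn] h i; first by rewrite expr0 mul1r subr0.
  by rewrite exprSr -mulrA IHn lvarM; congr (h _); lia.
case: e => n; first exact: natX.
have tn0 : lvar ^+ n.+1 != 0 by rewrite expf_neq0 ?lvar_neq0.
rewrite -[f in RHS](mulVKf tn0) natX.
by congr ((_ : laurent) _); lia.
Qed.

End Laurent.

Section Groups.
Variables (K : closedFieldType) (N : nat).

(** Polynomials in the N * N matrix entries. *)
Definition mxpoly_eval (R : comAlgType K) (f : {mpoly K[N * N]})
    (g : 'M[R]_N) : R :=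
  mmap (in_alg R) (fun l => mxvec g 0 l) f.

(** Over the algebraically closed field [K], a closed subgroup of GL_N is
    given by its group of [K]-points. *)
Record closed_subgroup (U : 'M[K]_N -> Prop) : Prop := ClosedSubgroup {
  csub_unit : forall g, U g -> g \in unitmx;
  csub_one : U 1%:M;
  csub_mul : forall g h, U g -> U h -> U (g *m h);
  csub_inv : forall g, U g -> U (invmx g);
  csub_closed : exists I : {mpoly K[N * N]} -> Prop, forall g,
    U g <-> g \in unitmx /\ forall f, I f -> f.@[fun l => mxvec g 0 l] = 0 }.

Definition unipotent_group (U : 'M[K]_N -> Prop) : Prop :=
  closed_subgroup U /\ forall g, U g -> exists r : nat, (g - 1%:M) ^+ r = 0.

Variable U : 'M[K]_N -> Prop.

Definition vanishing_ideal (f : {mpoly K[N * N]}) : Prop :=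
  forall g, U g -> f.@[fun l => mxvec g 0 l] = 0.

(** The group U(R). *)
Definition points (R : comAlgType K) (x : 'M[R]_N) : Prop :=
  (exists y : 'M[R]_N, x *m y = 1%:M /\ y *m x = 1%:M) /\
  forall f, vanishing_ideal f -> mxpoly_eval f x = 0.

(** The tangent space of U at the identity. *)
Definition lie_algebra (X : 'M[K]_N) : Prop :=
  forall f, vanishing_ideal f ->
    \sum_(l < N * N) (mderiv l f).@[fun l => mxvec 1%:M 0 l] * mxvec X 0 l = 0.

(** The Lie algebra tensored with R, as the R-span of the Lie algebra in the
    N x N matrices over R. *)
Definition lie_algebra_ext (R : comAlgType K) (A : 'M[R]_N) : Prop :=
  exists (r : nat) (c : 'I_r -> R) (X : 'I_r -> 'M[K]_N),
    (forall i, lie_algebra (X i)) /\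
    A = \sum_(i < r) c i *: map_mx (in_alg R) (X i).

Definition connection (A : 'M[laurent K]_N) : Prop := lie_algebra_ext A.

Definition coefmx (A : 'M[laurent K]_N) (j : int) : 'M[K]_N :=
  map_mx (fun f : laurent K => f j) A.

Definition of_powser (x : 'M[powser K]_N) : 'M[laurent K]_N := map_mx val x.

(** B = A mod t^e, for connections. *)
Definition connection_cong (e : int) (B A : 'M[laurent K]_N) : Prop :=
  exists2 C : 'M[powser K]_N,
    lie_algebra_ext C & B - A = (lvar K ^ e) *: of_powser C.

(** x = 1 mod t^e; for e >= 0 this says that x is in the kernel of
    GL_N(K[[t]]) -> GL_N(K[[t]]/(t^e)). *)
Definition cong1 (e : int) (x : 'M[powser K]_N) : Prop :=
  exists Y : 'M[powser K]_N,
    of_powser x - 1%:M = (lvar K ^ e) *: of_powser Y.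

Definition gauge (x A : 'M[laurent K]_N) : 'M[laurent K]_N :=
  x *m A *m invmx x + map_mx (@lderiv K) x *m invmx x.

Definition gauge_equivalent (A B : 'M[laurent K]_N) : Prop :=
  exists2 x : 'M[laurent K]_N, points x & gauge x A = B.

Fixpoint upper_central (i : nat) : 'M[K]_N -> Prop :=
  if i is i'.+1 then
    fun g => U g /\
      forall h, U h -> upper_central i' (g *m h *m invmx g *m invmx h)
  else fun g => g = 1%:M.

(** Normalized so that commutative groups, the trivial one included, have
    class 0: the class is the least [n] such that the [n.+1]-st term of the
    upper central series, which starts with the trivial group, is U. *)
Definition nilpotency_class (n : nat) : Prop :=
  (forall g, U g -> upper_central n.+1 g) /\
  forall i, (i < n)%N -> ~ forall g, U g -> upper_central i.+1 g.

End Groups.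

(* Main.v *)
(* The exponential identifies U with a nilpotent Lie algebra u of nilpotent
   matrices: u = {X | X nilpotent, exp X in U} is a subspace because
   log (exp sX exp sY) = s (X + Y) + O(s^2), and it contains the tangent space
   because the linear forms vanishing on u, composed with log, vanish on U.

   Let 0 = z_0 <= z_1 <= ... <= z_{n+1} = u be the upper central series of u.
   If B - A lies in z_{i+1} and has order k >= 0, take X = \int (B - A) dt;
   then exp X . A - B lies in z_i, and its order is at least k + 1 - a when
   t^a A is integral.  Descending from i = n + 1 to 0 and multiplying the
   n + 1 gauge transformations gives the result. *)

Require Import Defs.
From HB Require Import structures.
From mathcomp Require Import all_boot all_order all_algebra.
From mathcomp Require Import boolp mpoly zify ring.

Import Order.TTheory GRing.Theory Num.Theory.
Local Open Scope ring_scope.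

Set Implicit Arguments.
Unset Strict Implicit.
Unset Printing Implicit Defensive.

(** * Exponential and logarithm of matrices *)

(** The group is known only through its K-points, while the gauge transformations have power series
    entries. The bridge is a generic element of u with polynomial coordinates: its exponential lies
    in U at every K-valued parameter, so each equation of U holds identically and can be specialized
    to series. Limits and the Baker-Campbell-Hausdorff formula are avoided in the same spirit:
    truncated exp and log make every curve polynomial in s, and a polynomial condition known at all
    positive integers, where exp (sX) is a power of exp X, extends to s = 0 by characteristic 0. The
    constants come from counting orders. Each step may lower the order of the difference by a - 1,
    so the last of the n + 1 steps starts at order k - n(a - 1). This has to be nonnegative, since
    integration must not meet t^-1, and integrating adds 1. With a = |m| this gives the bound on k
    and the exponent k - n|m| + n + 1; for m > -1 the choice a = 1 loses nothing. *)

Section TruncatedSeries.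
Variable K : fieldType.
Hypothesis charK : [pchar K] =i pred0.

Lemma natr_neq0 (r : nat) : r.+1%:R != 0 :> K.
Proof. by have /pcharf0P -> := charK. Qed.

Lemma factr_neq0 (r : nat) : r`!%:R != 0 :> K.
Proof. by have /pcharf0P -> := charK; rewrite -lt0n fact_gt0. Qed.

Lemma bin_invf (r i : nat) : (i <= r)%N ->
  (r`!%:R)^-1 *+ 'C(r, i) = (i`!%:R)^-1 * ((r - i)`!%:R)^-1 :> K.
Proof.
move=> ir; rewrite -[LHS]mulr_natr -(bin_fact ir) !natrM.
have := factr_neq0 i; have := factr_neq0 (r - i).
have : ('C(r, i))%:R != 0 :> K by have /pcharf0P -> := charK; rewrite -lt0n bin_gt0.
by move=> *; field; apply/and3P; split.
Qed.

(** Characteristic 0 makes the positive integers distinct, which is more roots than a nonzero p can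
    have. Zero is left out because curves are later divided by their parameter. *)
Lemma poly_nat_eq0 (F : fieldType) (phi : {rmorphism K -> F}) (p : {poly F}) :
  (forall t : nat, p.[phi t.+1%:R] = 0) -> p = 0.
Proof.
move=> p0; apply/eqP; apply: contraT => pn0.
pose s := [seq phi t.+1%:R | t <- iota 0 (size p)].
have : (size s < size p)%N.
  apply: max_poly_roots => //; first by apply/allP => _ /mapP[t _ ->]; apply/rootP.
  rewrite map_inj_uniq ?iota_uniq // => a b /fmorph_inj /eqP.
  wlog ab : a b / (a <= b)%N => [H e|].
    by have /orP[] := leq_total a b => h; [exact: H|apply/esym/H; rewrite 1?eq_sym].
  rewrite eq_sym -subr_eq0 -natrB ?ltnS // subSS.
  by have /pcharf0P -> := charK; lia.
by rewrite size_map size_iota ltnn.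
Qed.

Definition texp (M : nat) : {poly K} := \poly_(r < M.+1) (r`!%:R)^-1.
(* The coefficient of X^0 is [- 1 / 0 = 0]. *)
Definition tlog (M : nat) : {poly K} := \poly_(r < M.+1) ((-1) ^+ r.+1 / r%:R).

(** Congruence modulo X^d; the explicit multiple dies at a matrix whose d-th power is 0. *)
Definition eqX (d : nat) (p q : {poly K}) := exists u, p = q + 'X^d * u.

Lemma eqX_coef d (p q : {poly K}) : (forall r, (r < d)%N -> p`_r = q`_r) -> eqX d p q.
Proof.
move=> pq; exists (drop_poly d (p - q)).
have : take_poly d (p - q) = 0.
  apply/polyP => r; rewrite coef_take_poly coef0 coefB; case: ifP => // /pq ->.
  by rewrite subrr.
have := poly_take_drop d (p - q) => + h; rewrite h add0r mulrC => ->.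
by rewrite addrC subrK.
Qed.

Lemma texp_expand (M : nat) : texp M.+1 = 1 + 'X * (\poly_(r < M.+1) (r.+1`!%:R)^-1).
Proof.
apply/polyP => -[|r]; rewrite !coefE /= ?addr0 ?fact0 ?invr1 //.
by rewrite add0r ltnS.
Qed.

Lemma tlog_expand (M : nat) :
  exists v, tlog M.+1 = 'X + 'X^2 * v.
Proof.
apply: eqX_coef => -[|[|//]] _; rewrite !coefE //=; first by rewrite invr0 mulr0.
by rewrite sqrrN expr1n divr1.
Qed.

Lemma deriv_texp (M : nat) : texp M = (texp M)^`() + (M`!%:R)^-1 *: 'X^M.
Proof.
apply/polyP => r; rewrite !coefE.
case: (ltngtP r M) => rM.
- rewrite ltnS (ltnW rM) ltnS rM mulr0 addr0 factS natrM invfM.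
  by rewrite -[RHS]mulr_natr mulrAC mulVf ?mul1r // natr_neq0.
- by rewrite !ifF ?mul0rn ?mulr0 ?addr0 //; lia.
- by rewrite rM ltnSn ltnn mul0rn add0r mulr1.
Qed.

Lemma deriv_tlog (M : nat) : (1 + 'X) * (tlog M)^`() = 1 - (-1) ^+ M *: 'X^M.
Proof.
have dL r : (tlog M)^`()`_r = if (r < M)%N then (-1) ^+ r else 0.
  rewrite !coefE ltnS; case: ifP => _; last by rewrite mul0rn.
  by rewrite -[LHS]mulr_natr divfK ?natr_neq0 // !exprS !mulN1r opprK.
apply/polyP => r; rewrite mulrDl mul1r coefD coefXM !dL !coefE.
case: r => [|r] /=.
  by case: M {dL} => [|M] /=; rewrite ?mulr1 ?subrr ?mulr0 ?subr0 ?addr0 ?expr0.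
have [rM|rM|<-] := ltngtP r.+1 M.
- by rewrite exprS mulr0 subr0 mulN1r addNr.
- by rewrite mulr0 subr0 addr0.
- by rewrite exprS mulr1 add0r sub0r mulN1r opprK.
Qed.

(* P := texp o tlog solves (1 + X) P' = P modulo X^M. *)
Lemma texp_tlog (M : nat) : eqX M.+1 (texp M \Po tlog M) (1 + 'X).
Proof.
case: M => [|M].
  apply: eqX_coef => -[|//] _; rewrite -horner_coef0 horner_comp.
  rewrite [(tlog 0).[0]]horner_coef0 coef_poly /= invr0 mulr0 horner_coef0.
  by rewrite !coefE /= fact0 invr1 addr0.
set P := _ \Po _.
have [v Lv] := tlog_expand M.
have P0 : P`_0 = 1.
  rewrite -horner_coef0 horner_comp [in X in X.[_]]texp_expand Lv.
  by rewrite !(hornerE, horner_exp) ?expr0n ?mul0r ?addr0 ?mul0r ?addr0.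
have odeP : (1 + 'X) * P^`() =
    P - 'X^(M.+1) * ((M.+1`!%:R)^-1 *: (1 + 'X * v) ^+ M.+1 +
      (-1) ^+ M.+1 *: ((texp M.+1)^`() \Po tlog M.+1)).
  rewrite /P deriv_comp mulrCA deriv_tlog.
  rewrite [in X in _ = X - _]deriv_texp comp_polyD comp_polyZ comp_Xn_poly.
  rewrite [in tlog _ ^+ _]Lv (_ : 'X + _ = 'X * (1 + 'X * v)); last by rewrite expr2; ring.
  by rewrite exprMn -!mul_polyC; ring.
apply: eqX_coef => r rM; clearbody P.
(* The equation gives (i + 1) P_{i+1} = (1 - i) P_i, so P_2 and all later coefficients vanish. *)
have rec (i : nat) : (i < M.+1)%N -> P`_i.+1 *+ i.+1 + P`_i *+ i = P`_i.
  move=> iM; move/(congr1 (fun p : {poly K} => p`_i)): odeP.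
  rewrite mulrDl mul1r coefD coefXM !coef_deriv coefB coefXnM iM subr0 => h; rewrite -[RHS]h.
  by case: i iM {h} => [|i] _ //=; rewrite ?mulr0n ?addr0.
have P1 : P`_1 = 1 by have := rec 0 isT; rewrite mulr0n addr0 mulr1n P0.
case: r rM => [|[|r]] rM; rewrite ?P0 ?P1 !coefE /= ?addr0 ?add0r //.
elim: r rM => [|r IHr] rM.
  have := rec 1%N rM; rewrite P1 mulr1n => /(canRL (addrK _)); rewrite subrr => /eqP.
  by rewrite -[X in X == 0]mulr_natr mulf_eq0 (negPf (natr_neq0 1)) orbF => /eqP.
have := rec r.+2 rM; rewrite IHr ?(ltnW rM) // mul0rn addr0 => /eqP.
by rewrite -[X in X == 0]mulr_natr mulf_eq0 (negPf (natr_neq0 _)) orbF => /eqP.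
Qed.

Lemma texp_add (M : nat) (a b : K) :
  eqX M.+1 ((texp M \Po (a *: 'X)) * (texp M \Po (b *: 'X)))
    (texp M \Po ((a + b) *: 'X)).
Proof.
have cE c r : (r < M.+1)%N -> (texp M \Po (c *: 'X))`_r = c ^+ r / r`!%:R.
  move=> rM; have rs : (r < size (texp M))%N.
    by rewrite size_poly_eq ?invr_eq0 ?factr_neq0.
  rewrite coef_comp_poly (bigD1 (Ordinal rs)) //= exprZn !coefE eqxx rM mulr1.
  rewrite big1 ?addr0 1?mulrC // => i; rewrite -val_eqE /= exprZn !coefE.
  by move=> /negPf; rewrite eq_sym => ->; rewrite !mulr0.
apply: eqX_coef => r rM; rewrite coefM cE // addrC exprDn mulr_suml.
apply: eq_bigr => i _; have ir : (i <= r)%N by rewrite -ltnS.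
rewrite !cE; [|lia|lia].
by rewrite mulrACA -bin_invf // mulrnAr mulrnAl [b ^+ _ * _]mulrC.
Qed.

End TruncatedSeries.

(* A matrix over K[s] is a curve of matrices over K. *)
Local Notation "A @@ s" := (map_mx (horner_eval s) A) (at level 20).
Local Notation poly_mx := (map_mx polyC).

Section MatrixExponential.
Variables (K : fieldType) (n : nat).
Hypothesis charK : [pchar K] =i pred0.

Section Ring.
Variables (R : comNzRingType) (iota : {rmorphism K -> R}).
Implicit Types A B : 'M[R]_n.+1.

(** The same polynomial over K is evaluated at matrices over K, K[s], polynomials in several
    variables, K[[t]] and K((t)), so that exp and log commute with base change. *)
Definition mxev (p : {poly K}) A := horner_mx A (map_poly iota p).
(** The degree [n.+1] keeps the linear term, on which all tangent computations rest, also for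
    matrices of size 1. *)
Definition expm A := mxev (texp K n.+1) A.
Definition logm A := mxev (tlog K n.+1) (A - 1).

Lemma mxevD p q A : mxev (p + q) A = mxev p A + mxev q A.
Proof. by rewrite /mxev !rmorphD. Qed.
Lemma mxevM p q A : mxev (p * q) A = mxev p A * mxev q A.
Proof. by rewrite /mxev !rmorphM. Qed.
Lemma mxevXn r A : mxev 'X^r A = A ^+ r.
Proof. by rewrite /mxev map_polyXn rmorphXn /= horner_mx_X. Qed.
Lemma mxevX A : mxev 'X A = A.
Proof. by rewrite /mxev map_polyX horner_mx_X. Qed.
Lemma mxev1 A : mxev 1 A = 1.
Proof. by rewrite /mxev !rmorph1. Qed.
Lemma mxevZ c p A : mxev (c *: p) A = iota c *: mxev p A.
Proof. by rewrite /mxev map_polyZ linearZ. Qed.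

Lemma mxev_sum (p : {poly K}) (d : nat) A : (size p <= d)%N ->
  mxev p A = \sum_(r < d) iota p`_r *: A ^+ r.
Proof.
move=> pd; rewrite {1}(_ : p = \sum_(r < d) p`_r *: 'X^r).
  rewrite /mxev !rmorph_sum; apply: eq_bigr => r _.
  by rewrite /= map_polyZ linearZ /= map_polyXn rmorphXn /= horner_mx_X.
rewrite -poly_def; apply/polyP => r; rewrite coef_poly.
by case: ltnP => // dr; rewrite nth_default // (leq_trans pd).
Qed.

Lemma mxev_comp p q A : mxev (p \Po q) A = mxev p (mxev q A).
Proof.
rewrite (mxev_sum _ (leqnn (size p))) comp_polyE /mxev !rmorph_sum.
apply: eq_bigr => r _.
by rewrite /= map_polyZ linearZ /= !rmorphXn.
Qed.

Lemma mxev_eqX d p q A : A ^+ d = 0 -> eqX d p q -> mxev p A = mxev q A.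
Proof. by move=> Ad [u ->]; rewrite mxevD mxevM mxevXn Ad mul0r addr0. Qed.

Lemma exprS_eq0 A : A ^+ n.+1 = 0 -> A ^+ n.+2 = 0.
Proof. by move=> A0; rewrite exprS A0 mulr0. Qed.

Lemma expm_logm A : (A - 1) ^+ n.+1 = 0 -> expm (logm A) = A.
Proof.
move=> /exprS_eq0 A0; rewrite /expm /logm -mxev_comp.
by rewrite (mxev_eqX A0 (texp_tlog charK _)) mxevD mxev1 mxevX addrC subrK.
Qed.

Lemma logm_nilp A : (A - 1) ^+ n.+1 = 0 -> logm A ^+ n.+1 = 0.
Proof.
move=> A0; have [v Lv] := tlog_expand K n.
rewrite /logm Lv (_ : _ + _ = 'X * (1 + 'X * v)); last by rewrite expr2; ring.
rewrite mxevM mxevX exprMn_comm ?A0 ?mul0r //.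
by rewrite /GRing.comm -{1 4}[_ - 1]mxevX -!mxevM mulrC.
Qed.

Lemma expm_expand A :
  expm A = 1 + A * mxev (\poly_(r < n.+1) (r.+1`!%:R)^-1) A.
Proof. by rewrite /expm texp_expand mxevD mxevM mxevX mxev1. Qed.

Lemma expm0 : expm 0 = 1.
Proof. by rewrite expm_expand mul0r addr0. Qed.

Lemma expm_addZ a b A : A ^+ n.+1 = 0 ->
  expm (iota a *: A) * expm (iota b *: A) = expm (iota (a + b) *: A).
Proof.
move=> /exprS_eq0 A0.
have cE c : expm (iota c *: A) = mxev (texp K n.+1 \Po (c *: 'X)) A.
  by rewrite mxev_comp mxevZ mxevX.
by rewrite !cE -mxevM (mxev_eqX A0 (texp_add charK _ _ _)).
Qed.

Lemma expmN A : A ^+ n.+1 = 0 -> expm A * expm (- A) = 1.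
Proof.
move=> A0; have := expm_addZ 1 (-1) A0.
by rewrite rmorphN rmorph1 scale1r scaleN1r subrr rmorph0 scale0r expm0.
Qed.

Lemma expmNl A : A ^+ n.+1 = 0 -> expm (- A) * expm A = 1.
Proof.
move=> A0; have := @expmN (- A); rewrite opprK; apply.
by rewrite exprNn A0 mulr0.
Qed.

Lemma expm_natZ A (t : nat) : A ^+ n.+1 = 0 ->
  expm (iota t%:R *: A) = expm A ^+ t.
Proof.
move=> A0; elim: t => [|t IHt]; first by rewrite rmorph0 scale0r expm0.
by rewrite exprSr -IHt -[X in _ = _ * expm X]scale1r -(rmorph1 iota) expm_addZ // -natr1.
Qed.

Lemma mxev_conj p A B C : C * B = 1 -> mxev p (B * A * C) = B * mxev p A * C.
Proof.
move=> CB; rewrite !(mxev_sum _ (leqnn (size p))) mulr_sumr mulr_suml.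
apply: eq_bigr => r _; rewrite -scalerAr -scalerAl; congr (_ *: _).
elim: (nat_of_ord r) => [|i IHi].
  by rewrite !expr0 mulr1; apply/esym; exact: mulmx1C.
by rewrite !exprS IHi -!mulrA (mulrA C) CB mul1r.
Qed.

End Ring.

Lemma map_mxev (R S : comNzRingType) (phi : {rmorphism R -> S})
    (iota : {rmorphism K -> R}) (iota' : {rmorphism K -> S}) p (A : 'M_n.+1) :
  (forall c, phi (iota c) = iota' c) ->
  map_mx phi (mxev iota p A) = mxev iota' p (map_mx phi A).
Proof.
move=> e; rewrite /mxev map_horner_mx -map_poly_comp; congr horner_mx.
by apply: eq_map_poly.
Qed.

Lemma ev_polyC (X : 'M[K]_n.+1) s : poly_mx X @@ s = X.
Proof. by apply/matrixP => i j; rewrite !mxE /horner_eval hornerC. Qed.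

Lemma ev_scaleX (W : 'M[{poly K}]_n.+1) s : ('X *: W) @@ s = s *: (W @@ s).
Proof. by apply/matrixP => i j; rewrite !mxE /horner_eval hornerM hornerX. Qed.

Lemma ev_mxev p (W : 'M[{poly K}]_n.+1) s :
  mxev polyC p W @@ s = mxev idfun p (W @@ s).
Proof. by apply: map_mxev => c; rewrite /= /horner_eval hornerC. Qed.

(** [H] is (exp (sX) - 1) / s, divided out in K[s]; its value at 0 stands for the derivative. *)
Lemma expm_curve (X : 'M[K]_n.+1) :
  exists2 H : 'M[{poly K}]_n.+1,
    expm polyC ('X *: poly_mx X) = 1 + 'X *: H & H @@ 0 = X.
Proof.
rewrite expm_expand -scalerAl; eexists; first by [].
rewrite map_mxM /= ev_polyC ev_mxev ev_scaleX scale0r.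
rewrite (mxev_sum _ _ (size_poly _ _)) big_ord_recl /= big1 => [|i _].
  by rewrite coef_poly /= factS fact0 muln1 expr0 invr1 scale1r addr0 mulmx1.
by rewrite expr0n /= scaler0.
Qed.

Lemma logm_curve (H : 'M[{poly K}]_n.+1) :
  exists2 W : 'M[{poly K}]_n.+1,
    logm polyC (1 + 'X *: H) = 'X *: W & W @@ 0 = H @@ 0.
Proof.
have [v Lv] := tlog_expand K n.
rewrite /logm addrC addKr Lv mxevD mxevX mxevM mxevXn exprZn expr2.
rewrite -scalerAl -scalerA -scalerDr; eexists; first by [].
by rewrite map_mxD ev_scaleX scale0r addr0.
Qed.

End MatrixExponential.

(** * Subspaces as solution sets of linear equations *)

Section Subspaces.
Variable K : fieldType.

Definition subspace (V : lmodType K) (S : V -> Prop) :=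
  S 0 /\ forall a u v, S u -> S v -> S (a *: u + v).

Lemma subspaceD (V : lmodType K) (S : V -> Prop) u v :
  subspace S -> S u -> S v -> S (u + v).
Proof. by case=> _ h Su Sv; rewrite -[u]scale1r; apply: h. Qed.

Lemma subspaceZ (V : lmodType K) (S : V -> Prop) a u :
  subspace S -> S u -> S (a *: u).
Proof. by case=> S0 h Su; rewrite -[_ *: _]addr0; apply: h. Qed.

Lemma subspaceN (V : lmodType K) (S : V -> Prop) u :
  subspace S -> S u -> S (- u).
Proof. by rewrite -scaleN1r; apply: subspaceZ. Qed.

Lemma subspaceB (V : lmodType K) (S : V -> Prop) u v :
  subspace S -> S u -> S v -> S (u - v).
Proof. by move=> hS Su Sv; apply: subspaceD => //; apply: subspaceN. Qed.

Lemma subspace_sum (V : lmodType K) (S : V -> Prop) (I : Type) (r : seq I)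
    (F : I -> V) : subspace S -> (forall i, S (F i)) -> S (\sum_(i <- r) F i).
Proof.
move=> hS SF; elim/big_ind: _ => //; first by case: hS.
by move=> u v; apply: subspaceD.
Qed.

(** A matrix [M] of maximal rank among those with row space inside S spans S, and [pinvmx M *m M]
    projects onto it. Membership becomes a linear system over K, which also makes sense for
    polynomial and series entries. *)
Lemma subspace_fixed (q : nat) (S : 'rV[K]_q -> Prop) : subspace S ->
  exists P : 'M[K]_q, (forall v, S (v *m P)) /\ forall v, S v <-> v *m P = v.
Proof.
move=> [S0 hS].
pose inS (r : nat) := `[< exists M : 'M[K]_q,
  \rank M = r /\ forall v : 'rV_q, (v <= M)%MS -> S v >].
have ex : exists r, inS r.
  exists 0; apply/asboolP; exists 0; rewrite mxrank0; split => // v.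
  by rewrite submx0 => /eqP ->.
have bnd r : inS r -> (r <= q)%N by move=> /asboolP[M [<- _]]; apply: rank_leq_row.
case: (ex_maxnP ex bnd) => r /asboolP[M [rM MS]] rmax.
have SM v : S (v *m (pinvmx M *m M)) by apply: MS; rewrite mulmxA submxMl.
exists (pinvmx M *m M); split=> // v; split=> [Sv|<-]; last exact: SM.
rewrite mulmxA; apply: mulmxKpV; apply: contraT => vM.
suff : inS (\rank (M + v)%MS).
  move=> /rmax; rewrite -rM leqNgt (ltn_leqif (mxrank_leqif_sup (addsmxSl _ _))).
  by rewrite addsmx_sub submx_refl (negPf vM).
apply/asboolP; exists (M + v)%MS; split => // w /sub_addsmxP[[u1 u2] /= ->].
rewrite addrC; have [c ->] : exists c, u2 = c%:M by exists (u2 0 0); apply: mx11_scalar.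
by rewrite mul_scalar_mx; apply: hS => //; apply: MS; apply: submxMl.
Qed.

Lemma subspace_mx_fixed (q : nat) (S : 'M[K]_q -> Prop) : subspace S ->
  exists P : 'M[K]_(q * q), (forall v, S (vec_mx (v *m P))) /\
    forall X, S X <-> mxvec X *m P = mxvec X.
Proof.
move=> hS; have [|P [SP hP]] := @subspace_fixed (q * q) (fun v => S (vec_mx v)).
  case: hS => S0 hS; split=> [|a u v Su Sv]; first by rewrite linear0.
  by rewrite linearP; apply: hS.
by exists P; split=> // X; rewrite -hP mxvecK.
Qed.

Hypothesis charK : [pchar K] =i pred0.

(** Along the curve the linear equations of S become polynomials in s with all positive integers as
    roots. At s = 0 this is the passage to the limit. *)
Lemma subspace_curve (q : nat) (S : 'M[K]_q -> Prop) (W : 'M[{poly K}]_q) s :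
  subspace S -> (forall t : nat, S (map_mx (horner_eval t.+1%:R) W)) ->
  S (map_mx (horner_eval s) W).
Proof.
move=> /subspace_mx_fixed[P [_ hP]] WS; apply/hP/eqP; rewrite -subr_eq0.
rewrite -{2}[mxvec _]mulmx1 -mulmxBr; apply/eqP/rowP => l.
pose p := (mxvec W *m map_mx polyC (P - 1%:M)) 0 l.
have pE c : p.[c] = (mxvec (map_mx (horner_eval c) W) *m (P - 1%:M)) 0 l.
  rewrite -map_mxvec /p !mxE horner_sum; apply: eq_bigr => i _.
  by rewrite !mxE hornerM hornerC.
rewrite -pE (_ : p = 0) ?horner0 ?mxE //.
apply: (poly_nat_eq0 charK (phi := idfun)) => t.
by have /hP h := WS t; rewrite pE mulmxBr h mulmx1 subrr mxE.
Qed.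

End Subspaces.

(** * Polynomial identities and differentials in several variables *)

Section MultivariateEvaluation.

Lemma eq_mmap (d : nat) (R S : nzRingType) (f g : R -> S) (h k : 'I_d -> S) p :
  f =1 g -> h =1 k -> mmap f h p = mmap g k p.
Proof.
move=> fg hk; apply: eq_bigr => m _; rewrite fg; congr (_ * _).
by apply: eq_bigr => i _; rewrite hk.
Qed.

Lemma rmorph_mmap (d : nat) (R S T : comNzRingType) (phi : {rmorphism S -> T})
    (f : R -> S) (h : 'I_d -> S) (p : {mpoly R[d]}) :
  phi (mmap f h p) = mmap (phi \o f) (phi \o h) p.
Proof.
rewrite /mmap rmorph_sum; apply: eq_bigr => m _; rewrite rmorphM; congr (_ * _).
by rewrite /mmap1 rmorph_prod; apply: eq_bigr => i _; rewrite rmorphXn.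
Qed.

Lemma mmap_comp (d e : nat) (K S : comNzRingType) (iota : {rmorphism K -> S})
    (h : 'I_e -> S) (G : 'I_d -> {mpoly K[e]}) (p : {mpoly K[d]}) :
  mmap iota h (mmap (@mpolyC e K) G p) = mmap iota (fun l => mmap iota h (G l)) p.
Proof. by rewrite rmorph_mmap; apply: eq_mmap => // c; rewrite /= mmapC. Qed.

(* One coordinate at a time is moved from K to F. *)
Lemma mmap_eq0 (K F : fieldType) (charK : [pchar K] =i pred0)
    (iota : {rmorphism K -> F}) (d : nat) (p : {mpoly K[d]}) :
  (forall a : 'I_d -> K, p.@[a] = 0) -> forall c, mmap iota c p = 0.
Proof.
move=> p0 c.
suff H (j : nat) : (j <= d)%N -> forall c : 'I_d -> F,
    (forall i : 'I_d, (j <= i)%N -> exists a, c i = iota a) -> mmap iota c p = 0.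
  by apply: (H d) => // i; rewrite leqNgt ltn_ord.
elim: j => [|j IHj] jd {}c cP.
  have /choice[a ca] : forall i, exists a, c i = iota a by move=> i; apply: cP.
  by rewrite (eq_mmap (g := iota \o idfun) _ _ ca) // -rmorph_mmap [mmap _ _ _]p0 rmorph0.
pose h (i : 'I_d) : {poly F} := if i == j :> nat then 'X else (c i)%:P.
pose q := mmap (polyC \o iota) h p.
have qE s : q.[s] = mmap iota (fun i : 'I_d => if i == j :> nat then s else c i) p.
  rewrite -/(horner_eval s q) rmorph_mmap; apply: eq_mmap => i /=.
    by rewrite /horner_eval hornerC.
  by rewrite /h /horner_eval; case: ifP; rewrite ?hornerX ?hornerC.
have q0 : q = 0.
  apply: (poly_nat_eq0 charK (phi := iota)) => t; rewrite qE IHj //; first exact: ltnW.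
  move=> i ji; case: eqP => [_|/eqP ij]; first by exists t.+1%:R.
  by apply: cP; rewrite ltn_neqAle eq_sym ij.
have := qE (c (Ordinal jd)); rewrite q0 horner0 => /esym; apply: etrans.
by apply: eq_mmap => // i; case: eqP => // ij; congr c; apply: val_inj.
Qed.

(** Chain rule along the line a + s b, which turns the equations of the tangent space into
    derivatives in one variable. Both sides obey the Leibniz rule, so the case of single variables
    generates the rest. *)
Lemma mderiv_line (K : comNzRingType) (d : nat) (p : {mpoly K[d]}) (a b : 'I_d -> K) :
  \sum_(l < d) (mderiv l p).@[a] * b l =
    (mmap polyC (fun l => (a l)%:P + b l *: 'X) p)^`().[0].
Proof.
pose h l := (a l)%:P + b l *: 'X; rewrite -/h.
have h0 (m : {mpoly K[d]}) : (mmap polyC h m).[0] = m.@[a].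
  rewrite -/(horner_eval 0 _) rmorph_mmap; apply: eq_mmap => i /=.
    by rewrite /horner_eval hornerC.
  by rewrite /horner_eval !hornerE ?mulr0 ?addr0.
have dM (u v : {mpoly K[d]}) :
    \sum_(l < d) (mderiv l u).@[a] * b l = (mmap polyC h u)^`().[0] ->
    \sum_(l < d) (mderiv l v).@[a] * b l = (mmap polyC h v)^`().[0] ->
    \sum_(l < d) (mderiv l (u * v)).@[a] * b l = (mmap polyC h (u * v))^`().[0].
  move=> hu hv; rewrite rmorphM derivM hornerD !hornerM /= !h0 -hu -hv.
  rewrite mulr_suml mulr_sumr -big_split; apply: eq_bigr => l _ /=.
  by rewrite mderivM mevalD !mevalM; ring.
have dX i : \sum_(l < d) (mderiv l 'X_i).@[a] * b l = (mmap polyC h 'X_i)^`().[0].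
  rewrite mmapX mmap1U derivD derivC derivZ derivX add0r alg_polyC hornerC.
  rewrite (bigD1 i) //= big1 ?addr0 => [|l li]; rewrite mderivX mnm1E.
    rewrite eqxx scale1r (_ : (_ - _)%MM = 0%MM) ?mpolyX0 ?meval1 ?mul1r //.
    by apply/mnmP => k; rewrite mnmBE mnm0E subnn.
  by rewrite eq_sym (negPf li) scale0r meval0 mul0r.
elim/mpolyind: p => [|c m p _ _ IHp].
  by rewrite rmorph0 deriv0 horner0 big1 // => l _; rewrite mderiv0 meval0 mul0r.
rewrite rmorphD derivD hornerD -IHp
  -[X in _ = X + _](_ : \sum_(l < d) (mderiv l (c *: 'X_[m])).@[a] * b l = _).
  by rewrite -big_split; apply: eq_bigr => l _ /=; rewrite mderivD mevalD mulrDl.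
rewrite -mul_mpolyC; apply: (dM).
  rewrite mmapC derivC horner0 big1 // => l _.
  by rewrite mderivC meval0 mul0r.
rewrite mpolyXE_id; elim/big_ind: (\prod_(i < d) _) => [|u v|i _]; [|exact: (dM)|].
  rewrite rmorph1 derivC horner0 big1 // => l _.
  by rewrite -mpolyC1 mderivC meval0 mul0r.
elim: (m i) => [|r IHr]; last by rewrite exprS; apply: dM.
rewrite expr0 rmorph1 derivC horner0 big1 // => l _.
by rewrite -mpolyC1 mderivC meval0 mul0r.
Qed.

End MultivariateEvaluation.

(** * The Lie algebra of a unipotent group *)

Lemma mul_curves (R : comNzRingType) (A : algType R) (x : R) (a y b : A) :
  (1 + x *: a) * y * (1 + x *: b) = y + x *: (a * y + y * b + x *: (a * y * b)).
Proof.
rewrite mulrDl mul1r mulrDr mulr1 mulrDl -!scalerAr -!scalerAl !scalerDr.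
by rewrite -!addrA.
Qed.

Section UnipotentGroup.
Variables (K : closedFieldType) (n : nat) (U : 'M[K]_n.+1 -> Prop).
Hypothesis charK : [pchar K] =i pred0.
Hypothesis unipU : unipotent_group U.

Local Notation exp := (expm (idfun : {rmorphism K -> K})).
Local Notation log := (logm (idfun : {rmorphism K -> K})).
Local Notation nilp A := (A ^+ n.+1 = 0).

Lemma unipotent_mem g :
  U g <-> g \in unitmx /\
    forall f, vanishing_ideal U f -> f.@[fun l => mxvec g 0 l] = 0.
Proof.
have [[U_unit _ _ _ [I UI]] _] := unipU; split=> [Ug|[g_unit gf]].
  by split=> [|f]; [exact: U_unit|apply].
by apply/UI; split=> // f If; apply: gf => h /UI[_]; apply.
Qed.

(** The minimal polynomial of g - 1 divides a power of X, so up to a unit it is such a power, of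
    degree at most the size of the matrix. This makes the exponent uniform in g. *)
Lemma unipotent_nilp g : U g -> nilp (g - 1).
Proof.
have [_ unipV] := unipU; move=> /unipV[r gr].
have : mxminpoly (g - 1) %| 'X^r.
  by apply: mxminpoly_min; rewrite rmorphXn /= horner_mx_X.
rewrite -['X]subr0 -polyC0 => /dvdp_exp_XsubCP[k _ mk].
have kn : (k <= n.+1)%N.
  rewrite -ltnS -(size_exp_XsubC k (0 : K)) -(eqp_size mk) -(size_char_poly (g - 1)).
  apply: dvdp_leq (mxminpoly_dvd_char _).
  by rewrite -size_poly_gt0 size_char_poly.
have : mxminpoly (g - 1) %| 'X^(n.+1).
  by rewrite (eqp_dvdl _ mk) subr0 dvdp_exp2l.
by move=> /mxminpoly_minP; rewrite rmorphXn /= horner_mx_X.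
Qed.

Lemma unip_unit (A : 'M[K]_n.+1) : nilp A -> exp A \in unitmx.
Proof. by move=> /(expmN charK idfun) /mulmx1_unit[]. Qed.

Lemma unipotent_exp g t : U g -> U (g ^+ t).
Proof.
have [[_ U1 UM _ _] _] := unipU => Ug; elim: t => [|t IHt]; first exact: U1.
by rewrite exprS; apply: UM.
Qed.

(** Each equation of U pulls back to a polynomial in s vanishing at all positive integers.
    Invertibility at s is assumed because U is closed in GL only. *)
Lemma unipotent_curve (G : 'M[{poly K}]_n.+1) s :
  (forall t : nat, U (G @@ t.+1%:R)) -> G @@ s \in unitmx -> U (G @@ s).
Proof.
move=> GU Gs; apply/unipotent_mem; split=> // f fU.
pose p := mmap polyC (fun l => mxvec G 0 l) f.
have pE c : p.[c] = f.@[fun l => mxvec (G @@ c) 0 l].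
  rewrite -/(horner_eval c p) rmorph_mmap; apply: eq_mmap => l.
    by rewrite /= /horner_eval hornerC.
  by rewrite -map_mxvec mxE.
rewrite -pE (_ : p = 0) ?horner0 //.
apply: (poly_nat_eq0 charK (phi := idfun)) => t.
by rewrite pE; apply: fU; apply: GU.
Qed.

(* This is the Lie algebra of U. *)
Definition logset (X : 'M[K]_n.+1) := nilp X /\ U (exp X).

Lemma logset_log g : U g -> logset (log g).
Proof.
move=> Ug; have g1 := unipotent_nilp Ug.
by split; [exact: logm_nilp|rewrite expm_logm].
Qed.

Lemma nilp_scale c (X : 'M[K]_n.+1) : nilp X -> nilp (c *: X).
Proof. by move=> X0; rewrite exprZn X0 scaler0. Qed.

Lemma nilp_conj (X B C : 'M[K]_n.+1) : C * B = 1 -> nilp X -> nilp (B * X * C).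
Proof.
move=> CB X0; rewrite -(mxevXn (idfun : {rmorphism K -> K})) mxev_conj //.
by rewrite mxevXn X0 mulr0 mul0r.
Qed.

Lemma expm_curve_ev (X : 'M[K]_n.+1) s :
  expm polyC ('X *: poly_mx X) @@ s = exp (s *: X).
Proof. by rewrite ev_mxev ev_scaleX ev_polyC. Qed.

Lemma exp_nat (X : 'M[K]_n.+1) (t : nat) : nilp X -> exp (t%:R *: X) = exp X ^+ t.
Proof. exact: (expm_natZ charK (idfun : {rmorphism K -> K})). Qed.

Lemma ev_expm (W : 'M[{poly K}]_n.+1) s : expm polyC W @@ s = exp (W @@ s).
Proof. exact: ev_mxev. Qed.

(** For a positive integer c this is exp (cX) = (exp X)^c; the curve of exponentials carries it to
    all scalars. *)
Lemma logset_scale c X : logset X -> logset (c *: X).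
Proof.
move=> [X0 UX]; split; first exact: nilp_scale.
rewrite -expm_curve_ev; apply: unipotent_curve => [t|].
  by rewrite expm_curve_ev exp_nat //; apply: unipotent_exp.
by rewrite expm_curve_ev; apply/unip_unit/nilp_scale.
Qed.

(** Passage to the limit before [logset] is known to be a subspace: nilpotency and membership of the
    exponential are polynomial conditions, treated separately. *)
Lemma logset_curve (W : 'M[{poly K}]_n.+1) :
  (forall t : nat, logset (W @@ t.+1%:R)) -> logset (W @@ 0).
Proof.
move=> hW.
have W0 : nilp (W @@ 0).
  have := @subspace_curve K charK n.+1 (fun X => X = 0) (W ^+ n.+1) 0.
  rewrite rmorphXn; apply; last by move=> t; rewrite rmorphXn; case: (hW t).
  by split=> // a u v -> ->; rewrite scaler0 addr0.
split=> //; rewrite -ev_expm; apply: unipotent_curve; last first.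
  by rewrite ev_expm; apply: unip_unit.
by move=> t; rewrite ev_expm; case: (hW t).
Qed.

(* The linear term at s = 0 of the logarithm of a curve through 1. *)
Lemma logset_log_curve (H : 'M[{poly K}]_n.+1) (S : 'M[K]_n.+1 -> Prop) :
  (forall c X, S X -> S (c *: X)) ->
  (forall s, U ((1 + 'X *: H) @@ s)) ->
  (forall X, logset X -> (exists s, exp X = (1 + 'X *: H) @@ s) -> S X) ->
  exists2 W : 'M[{poly K}]_n.+1,
    W @@ 0 = H @@ 0 & forall t : nat, S (W @@ t.+1%:R).
Proof.
move=> SZ HU HS; have [W WE W0] := logm_curve H; exists W => // t.
have t0 := natr_neq0 charK t.
have WtE : W @@ t.+1%:R = t.+1%:R^-1 *: log ((1 + 'X *: H) @@ t.+1%:R).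
  have <- : ('X *: W) @@ t.+1%:R = log ((1 + 'X *: H) @@ t.+1%:R).
    by rewrite -WE ev_mxev rmorphB rmorph1.
  by rewrite ev_scaleX scalerA mulVf // scale1r.
rewrite WtE; apply: SZ; have Ut := HU t.+1%:R.
apply: HS; first exact: logset_log.
by exists t.+1%:R; rewrite expm_logm //; apply: unipotent_nilp.
Qed.

Lemma logset_add X Y : logset X -> logset Y -> logset (X + Y).
Proof.
move=> hX hY; have [HX eX X0] := expm_curve X; have [HY eY Y0] := expm_curve Y.
pose H := HX + HY + 'X *: (HX * HY).
have HE : 1 + 'X *: H = expm polyC ('X *: poly_mx X) * expm polyC ('X *: poly_mx Y).
  by rewrite eX eY -[1 + 'X *: HX]mulr1 mul_curves !mulr1 mul1r.
have [||W W0 hW] := @logset_log_curve H logset logset_scale.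
- move=> s; rewrite HE rmorphM /= !expm_curve_ev; have [[_ _ UM _ _] _] := unipU.
  by apply: UM; [case: (logset_scale s hX)|case: (logset_scale s hY)].
- by [].
have := logset_curve hW; rewrite W0 /H !rmorphD /= X0 Y0 ev_scaleX scale0r addr0.
by [].
Qed.

Lemma logset_subspace : subspace logset.
Proof.
have [[_ U1 _ _ _] _] := unipU.
split; last by move=> a u v hu hv; apply/logset_add/hv/logset_scale.
by split; [rewrite expr0n|rewrite expm0].
Qed.

Lemma logset_conj (g X : 'M[K]_n.+1) : U g -> logset X -> logset (g * X * invmx g).
Proof.
have [[U_unit _ UM UV _] _] := unipU => Ug [X0 UX].
have gV : invmx g * g = 1 by apply/mulVmx/U_unit.
split; first exact: nilp_conj.
by rewrite /expm mxev_conj //; apply: (UM); [apply: UM|apply: UV].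
Qed.

Lemma invmx_exp (X : 'M[K]_n.+1) : nilp X -> invmx (exp X) = exp (- X).
Proof.
move=> X0; have XV := expmN charK (idfun : {rmorphism K -> K}) X0.
have VX : invmx (exp X) * exp X = 1 by apply/mulVmx/unip_unit.
by rewrite -[LHS]mulr1 -XV mulrA VX mul1r.
Qed.

Lemma adjoint_curve (X Y : 'M[K]_n.+1) : exists2 H : 'M[{poly K}]_n.+1,
  forall s, s *: (H @@ s) = exp (s *: X) * Y * exp (s *: - X) - Y &
  H @@ 0 = X * Y - Y * X.
Proof.
have [HX eX X0] := expm_curve X; have [HY eY Y0] := expm_curve (- X).
exists (HX * poly_mx Y + poly_mx Y * HY + 'X *: (HX * poly_mx Y * HY)); last first.
  by rewrite !rmorphD !rmorphM /= ev_scaleX scale0r addr0 X0 Y0 !ev_polyC mulrN.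
move=> s; rewrite -ev_scaleX -!expm_curve_ev -[in RHS](ev_polyC Y s) -!rmorphM -rmorphB /=.
rewrite eX eY mul_curves.
by rewrite [poly_mx Y + _]addrC addrK.
Qed.

(* The Lie bracket is the velocity at s = 0 of the adjoint action of exp (s X). *)
Lemma bracket_mem (S : 'M[K]_n.+1 -> Prop) X Y : subspace S ->
  (forall t : nat, S (exp (t.+1%:R *: X) * Y * exp (t.+1%:R *: - X) - Y)) ->
  S (X * Y - Y * X).
Proof.
move=> hS SXY; have [H HE <-] := adjoint_curve X Y.
apply: subspace_curve => // t.
have t0 := natr_neq0 charK t.
have -> : H @@ t.+1%:R = t.+1%:R^-1 *: (t.+1%:R *: (H @@ t.+1%:R)).
  by rewrite scalerA mulVf // scale1r.
by rewrite HE; apply: subspaceZ.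
Qed.

Lemma lie_algebra_logset X : lie_algebra U X -> logset X.
Proof.
move=> hX; have [P [_ hP]] := subspace_mx_fixed logset_subspace.
apply/hP/eqP; rewrite -subr_eq0 -{2}[mxvec X]mulmx1 -mulmxBr; apply/eqP/rowP => l.
pose mpC : {rmorphism K -> _} := @mpolyC (n.+1 * n.+1) K.
(* [G] is the generic matrix. As log is truncated, [f] is a polynomial in the entries: a linear form
   vanishing on [logset], composed with log. *)
pose G : 'M[{mpoly K[n.+1 * n.+1]}]_n.+1 := vec_mx (\row_i 'X_i).
pose f := (mxvec (logm mpC G) *m map_mx mpC (P - 1%:M)) 0 l.
have fE (R : comNzRingType) (iota : {rmorphism K -> R}) (g : 'M[R]_n.+1) :
    mmap iota (fun i => mxvec g 0 i) f =
      (mxvec (logm iota g) *m map_mx iota (P - 1%:M)) 0 l.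
  pose phi : {rmorphism _ -> _} := mmap iota (fun i => mxvec g 0 i).
  have phiC c : phi (mpC c) = iota c by rewrite /phi /= mmapC.
  have phiG : map_mx phi G = g.
    apply/(can_inj mxvecK)/rowP => i; rewrite -map_mxvec vec_mxK !mxE.
    by rewrite /phi /= mmapX mmap1U.
  have <- : map_mx phi (logm mpC G) = logm iota g.
    by rewrite (map_mxev _ _ phiC) map_mxB map_mx1 phiG.
  have <- : map_mx phi (map_mx mpC (P - 1%:M)) = map_mx iota (P - 1%:M).
    by apply/matrixP => i j; rewrite !mxE phiC.
  by rewrite -map_mxvec -map_mxM mxE.
have := hX f; rewrite mderiv_line => hf.
have -> : (mxvec X *m (P - 1%:M)) 0 l =
    (mmap polyC (fun i => (mxvec 1%:M 0 i)%:P + mxvec X 0 i *: 'X) f)^`().[0].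
  have [H HE H0] := logm_curve (poly_mx X).
  rewrite (eq_mmap (g := polyC) (k := fun i => mxvec (1 + 'X *: poly_mx X) 0 i)) //.
    rewrite fE HE linearZ -scalemxAl [in RHS]mxE derivM derivX mul1r hornerD hornerM hornerX.
    rewrite mul0r addr0 /= [in RHS]mxE horner_sum [LHS]mxE.
    apply: eq_bigr => i _; rewrite hornerM [in RHS]mxE hornerC; congr (_ * _).
    by rewrite -[X in LHS](ev_polyC X 0) -H0 -map_mxvec mxE.
  move=> i; rewrite linearD linearZ /= -map_mxvec !mxE mulrC -mul_polyC.
  congr (_ + _); case/mxvec_indexP: i => i j; rewrite !mxvecE !mxE.
  by case: eqP.
rewrite hf ?mxE // => g Ug.
apply: etrans (fE K idfun g) _.
have /hP h := logset_log Ug.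
rewrite (_ : map_mx idfun _ = P - 1%:M); last by apply/matrixP => i j; rewrite mxE.
by rewrite mulmxBr mulmx1 h subrr mxE.
Qed.

(** * Comparison of the central series of the group and of its Lie algebra *)

Fixpoint lie_central (i : nat) (X : 'M[K]_n.+1) : Prop :=
  if i is i'.+1 then
    logset X /\ forall Y, logset Y -> lie_central i' (X * Y - Y * X)
  else X = 0.

Lemma lie_central_subspace i : subspace (lie_central i).
Proof.
elim: i => [|i IHi] /=; first by split=> // a u v -> ->; rewrite scaler0 addr0.
split=> [|a u v [hu cu] [hv cv]].
  split=> [|Y _]; first by case: logset_subspace.
  by rewrite mul0r mulr0 subrr; case: IHi.
split=> [|Y hY]; first by case: logset_subspace => _; apply.
have -> : (a *: u + v) * Y - Y * (a *: u + v) = a *: (u * Y - Y * u) + (v * Y - Y * v).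
  by rewrite mulrDl mulrDr -scalerAl -scalerAr opprD addrACA scalerBr.
by case: IHi => _; apply; [apply: cu|apply: cv].
Qed.

Lemma lie_central_logset i X : lie_central i X -> logset X.
Proof. by case: i => [->|i []] //; case: logset_subspace. Qed.

Lemma lie_centralS i X : lie_central i X -> lie_central i.+1 X.
Proof.
elim: i X => [|i IHi] X hX.
  split; first exact: lie_central_logset hX.
  by move=> Y _; rewrite hX mul0r mulr0 subrr.
by case: hX => hX cX; split=> // Y hY; apply/IHi/cX.
Qed.

(** Two derivatives turn commutators into brackets. With g = exp X and Z in the Lie algebra, the
    commutators of g with exp (sZ) lie one term lower, and by induction so does their velocity at s
    = 0, which is Ad(g) Z - Z. Passing to powers of g and differentiating in the exponent gives
    [X, Y]. *)
Lemma upper_central_lie i X :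
  logset X -> upper_central U i (exp X) -> lie_central i X.
Proof.
have [[U_unit U1 UM UV _] _] := unipU.
elim: i X => [|i IHi] X hX /= cX.
  (* As exp X = 1, the curve exp (sX) is 1 at all positive integers, so [H] vanishes there and hence
     at 0. *)
  have [H HE H0] := expm_curve X; rewrite -[LHS]H0.
  have S0 : subspace (fun Y : 'M[K]_n.+1 => Y = 0).
    by split=> // a u v -> ->; rewrite scaler0 addr0.
  apply: (subspace_curve charK) S0 _ => t; have t0 := natr_neq0 charK t.
  have -> : H @@ t.+1%:R = t.+1%:R^-1 *: (('X *: H) @@ t.+1%:R).
    by rewrite ev_scaleX scalerA mulVf // scale1r.
  have -> : 'X *: H = expm polyC ('X *: poly_mx X) - 1 by rewrite HE addrC addKr.
  by rewrite rmorphB rmorph1 /= expm_curve_ev exp_nat ?cX ?expr1n ?subrr ?scaler0 //; case: hX.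
have hS := lie_central_subspace i.
case: cX => Ug cX; split=> // Y hY.
set g := exp X in Ug cX; have g_unit := U_unit _ Ug.
have gV : invmx g * g = 1 by apply: mulVmx.
have Vg : g * invmx g = 1 by apply: mulmxV.
have adg Z : logset Z -> lie_central i (g * Z * invmx g - Z).
  move=> hZ; have hgZ := logset_conj Ug hZ.
  have [H1 e1 H10] := expm_curve (g * Z * invmx g); have [H2 e2 H20] := expm_curve (- Z).
  pose H := H1 + H2 + 'X *: (H1 * H2).
  have HE : 1 + 'X *: H =
      expm polyC ('X *: poly_mx (g * Z * invmx g)) * expm polyC ('X *: poly_mx (- Z)).
    by rewrite e1 e2 -[1 + 'X *: H1]mulr1 mul_curves !mulr1 mul1r.
  have HsE s : (1 + 'X *: H) @@ s = g * exp (s *: Z) * invmx g * invmx (exp (s *: Z)).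
    have [sZ0 _] := logset_scale s hZ.
    rewrite HE rmorphM /= !expm_curve_ev (invmx_exp sZ0) scalerN; congr (_ * _).
    by rewrite /expm -mxev_conj // -scalerAr -scalerAl.
  have UZ s : U (exp (s *: Z)) by case: (logset_scale s hZ).
  have [|||W W0 hW] := @logset_log_curve H (lie_central i).
  - by move=> c V hV; apply: subspaceZ.
  - move=> s; rewrite HsE; apply: (UM); first by apply: (UM); [apply: UM|apply: UV].
    exact: UV.
  - by move=> V hV [s VE]; apply: IHi => //; rewrite VE HsE; apply: cX.
  have := subspace_curve charK 0 hS hW.
  by rewrite W0 /H !rmorphD /= ev_scaleX scale0r addr0 H10 H20.
apply: bracket_mem (hS) _ => t.
have [X0 _] := hX.
have eXt s : exp (s%:R *: X) = g ^+ s by rewrite exp_nat.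
have -> : exp (t.+1%:R *: - X) = invmx g ^+ t.+1.
  by rewrite exp_nat -?invmx_exp // exprNn X0 mulr0.
rewrite eXt; elim: t.+1 => [|r IHr].
  by rewrite !expr0 mul1r mulr1 subrr; case: hS.
rewrite exprS exprSr.
set Z := g ^+ r * Y * invmx g ^+ r in IHr *.
(* Telescoping: with Z = Ad(g)^r Y, the difference for r + 1 is Ad(g) Z - Z plus the difference for
   r. *)
have -> : g * g ^+ r * Y * (invmx g ^+ r * invmx g) - Y =
    (g * Z * invmx g - Z) + (Z - Y) by rewrite addrA subrK /Z !mulrA.
apply: subspaceD => //; apply: adg.
rewrite -[Z](subrK Y); apply: subspaceD (hY); first exact: logset_subspace.
exact: lie_central_logset IHr.
Qed.

Lemma lie_central_full c X :
  (forall g, U g -> upper_central U c g) -> logset X -> lie_central c X.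
Proof. by move=> Uc hX; apply: upper_central_lie => //; apply: Uc; case: hX. Qed.

End UnipotentGroup.

(** * The effect of a derivation on an exponential *)

Section Derivations.
Variables (K F : fieldType) (iota : {rmorphism K -> F}) (R : algType F).
Hypothesis charK : [pchar K] =i pred0.
Variables (delta : {additive R -> R}) (X : R).
Hypothesis deltaM : forall u v, delta (u * v) = delta u * v + u * delta v.
Hypothesis deltaZ : forall c u, delta (iota c *: u) = iota c *: delta u.

Let ad (Z : R) := X * Z - Z * X.
Let W := delta X.

(** Leibniz puts [W] between powers of X; the rule X Z = Z X + [ad Z] moves them all to its right,
    and Pascal's rule counts the terms. *)
Lemma delta_exp r :
  delta (X ^+ r) = \sum_(j < r) (iter j ad W * X ^+ (r - j.+1)) *+ 'C(r, j.+1).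
Proof.
elim: r => [|r IHr].
  rewrite big_ord0 expr0; apply: (addrI (delta 1)); rewrite addr0.
  by rewrite -[in RHS](mulr1 1) deltaM mulr1 mul1r.
rewrite exprS deltaM IHr mulr_sumr.
under [in RHS]eq_bigr do rewrite binS mulrnDr.
rewrite big_split /= big_ord_recr /= bin_small // mulr0n addr0.
rewrite [X in _ = _ + X]big_ord_recl /= bin0 mulr1n subn1 /= addrCA -big_split /=.
congr (_ + _); apply: eq_bigr => j _.
rewrite mulrnAr -mulrnDl; congr (_ *+ _); rewrite /bump /= add1n !subSS.
have -> : (r - j = (r - j.+1).+1)%N by rewrite subnSK.
by rewrite exprS /ad mulrBl !mulrA addrC subrK.
Qed.

Lemma big_ord_shift (V : nmodType) (h : nat -> V) (d j M : nat) :
  (j + d < M)%N -> (forall s, (d <= s)%N -> h s = 0) ->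
  \sum_(r < M | (j < r)%N) h (r - j.+1)%N = \sum_(s < d) h s.
Proof.
move=> dM h0; rewrite -(big_geq_mkord j.+1 M predT (fun r => h (r - j.+1)%N)).
rewrite -{1}[j.+1]add0n big_addn (@big_cat_nat _ _ _ d) /=; [|lia|lia].
have -> : \sum_(d <= i < M - j.+1 | true) h (i + j.+1 - j.+1)%N = 0.
  by rewrite big_nat_cond big1 // => i /andP[/andP[di _] _]; rewrite addnK h0.
by rewrite addr0 big_mkord; apply: eq_bigr => i _; rewrite addnK.
Qed.

(** This is delta(exp X) = ((e^(ad X) - 1) / ad X)(delta X) exp X. Dividing the binomial of
    [delta_exp] by r! splits it as 1/(j+1)! times 1/(r-j-1)!, so the double sum is a product. *)
Lemma delta_expm (d q : nat) : X ^+ d = 0 -> iter q ad W = 0 ->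
  delta (\sum_(r < d) iota (r`!%:R)^-1 *: X ^+ r) =
  (\sum_(j < q) iota (j.+1`!%:R)^-1 *: iter j ad W) *
    (\sum_(r < d) iota (r`!%:R)^-1 *: X ^+ r).
Proof.
move=> Xd adq.
have Xs s : (d <= s)%N -> X ^+ s = 0.
  by move=> ds; rewrite -(subnK ds) exprD Xd mulr0.
have ad0 : ad 0 = 0 by rewrite /ad mul0r mulr0 subrr.
have ads j : (q <= j)%N -> iter j ad W = 0.
  move=> qj; rewrite -(subnK qj) iterD adq.
  by elim: (j - q)%N => [|i IHi] //=; rewrite IHi.
(* Large enough that r - j - 1 takes all values below d for every j < q. *)
pose M := (q + d).+1.
have dM : (d <= M)%N by rewrite /M; lia.
pose c r := iota (r`!%:R)^-1; pose h r := c r *: X ^+ r.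
have cbin r j : (j < r)%N -> c r *+ 'C(r, j.+1) = c j.+1 * c (r - j.+1)%N.
  by move=> jr; rewrite /c -rmorphM -rmorphMn bin_invf.
have -> : \sum_(r < d) iota (r`!%:R)^-1 *: X ^+ r = \sum_(r < M) h r.
  rewrite (big_ord_widen_cond _ predT h dM) [RHS](bigID (fun r : 'I_M => (r < d)%N)) /=.
  rewrite [X in _ = _ + X]big1 ?addr0 // => r; rewrite -leqNgt => dr.
  by rewrite /h Xs // scaler0.
rewrite raddf_sum mulr_suml.
transitivity (\sum_(r < M) \sum_(j < M | (j < r)%N)
    (c j.+1 *: iter j ad W) * h (r - j.+1)%N).
  apply: eq_bigr => r _; rewrite /h deltaZ delta_exp scaler_sumr.
  rewrite (big_ord_widen_cond M predT
    (fun j => c r *: ((iter j ad W * X ^+ (r - j.+1)) *+ 'C(r, j.+1)))) ?(ltnW (ltn_ord r)) //.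
  apply: eq_bigr => j jr; rewrite -scalerMnr scalerMnl cbin //.
  by rewrite /h -scalerAl -scalerAr scalerA.
rewrite (exchange_big_dep predT) //=.
have qM : (q <= M)%N by rewrite /M; lia.
rewrite (big_ord_widen_cond M predT (fun j => c j.+1 *: iter j ad W * \sum_(r < M) h r) qM).
rewrite [LHS](bigID (fun j : 'I_M => (j < q)%N)) /= [X in _ + X]big1 ?addr0; last first.
  by move=> j; rewrite -leqNgt => qj; rewrite big1 // => r _; rewrite ads // scaler0 mul0r.
apply: eq_bigr => j jq; rewrite -mulr_sumr; congr (_ * _).
have hs s : (d <= s)%N -> h s = 0 by move=> ds; rewrite /h Xs // scaler0.
rewrite (big_ord_shift (d := d) _ hs); last first.
  by rewrite ltnS leq_add2r ltnW.
rewrite (big_ord_widen_cond M predT h dM) [RHS](bigID (fun r : 'I_M => (r < d)%N)) /=.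
by rewrite [X in _ = _ + X]big1 ?addr0 // => r; rewrite -leqNgt => /hs.
Qed.

End Derivations.

(** * Matrices of Laurent series *)

Section LaurentMatrices.
Variables (K : closedFieldType) (n : nat).
Hypothesis charK : [pchar K] =i pred0.
Local Notation F := (laurent K).
Local Notation iota := (in_alg F : {rmorphism K -> F}).
Implicit Types (A B : 'M[F]_n.+1) (S : 'M[K]_n.+1 -> Prop) (p q j : int).

Lemma intr_neq0 j : j != 0 -> j%:~R != 0 :> K.
Proof.
have /pcharf0P natK := charK.
by case: j => [r|r] r0; rewrite ?NegzE ?mulrNz ?oppr_eq0 -pmulrn natK.
Qed.

Lemma lderiv_is_additive : zmod_morphism (@lderiv K).
Proof. by move=> f g; apply: laurentP => j /=; rewrite mulrzBl. Qed.
HB.instance Definition _ :=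
  GRing.isZmodMorphism.Build F F (@lderiv K) lderiv_is_additive.

Lemma lderivM (f g : F) : lderiv (f * g) = lderiv f * g + f * lderiv g.
Proof.
have [[p hp] [q hq]] := (lcoefP f, lcoefP g).
have hp' j : j < p - 1 -> lderiv f j = 0 by move=> jp /=; rewrite hp ?mul0rz //; lia.
have hq' j : j < q - 1 -> lderiv g j = 0 by move=> jq /=; rewrite hq ?mul0rz //; lia.
apply: laurentP => j.
change (conv f g (j + 1) *~ (j + 1) = conv (lderiv f) g j + conv f (lderiv g) j).
have [jpq|/int_split[r jE]] := ltP j (p - 1 + q).
  rewrite (conv_low hp hq) ?(conv_low hp' hq) ?(conv_low hp hq') ?mul0rz ?addr0 //; lia.
have -> : j + 1 = p + q + r%:Z by lia.
rewrite (conv_shift _ hp hq) {1}jE (conv_shift _ hp' hq).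
have -> : j = p + (q - 1) + r%:Z by lia.
rewrite (conv_shift _ hp hq') -big_split /= mulrz_suml.
apply: eq_bigr => i _; have := ltn_ord i => ir.
have -> : p - 1 + i%:Z + 1 = p + i%:Z by lia.
have -> : q - 1 + (r - i)%:Z + 1 = q + (r - i)%:Z by lia.
rewrite mulrzAl mulrzAr -mulrzDr; congr (_ *~ _); lia.
Qed.

Lemma lderivZ c (f : F) : lderiv (c *: f) = c *: lderiv f.
Proof. by apply: laurentP => j /=; rewrite mulrzAr. Qed.

Definition mxderiv A := map_mx (@lderiv K) A.

Lemma mxderivM A B : mxderiv (A * B) = mxderiv A * B + A * mxderiv B.
Proof.
apply/matrixP => i j; rewrite !mxE raddf_sum -big_split.
by apply: eq_bigr => l _; rewrite !mxE /= lderivM.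
Qed.

Lemma coefmxD A B j : coefmx (A + B) j = coefmx A j + coefmx B j.
Proof. by apply/matrixP => a b; rewrite !mxE. Qed.
Lemma coefmxN A j : coefmx (- A) j = - coefmx A j.
Proof. by apply/matrixP => a b; rewrite !mxE. Qed.
Lemma in_algM c (f : F) : iota c * f = c *: f.
Proof. exact: mulr_algl. Qed.
Lemma coefmxZ c A j : coefmx (iota c *: A) j = c *: coefmx A j.
Proof. by apply/matrixP => a b; rewrite !mxE in_algM. Qed.
Lemma coefmx0 j : coefmx (0 : 'M[F]_n.+1) j = 0.
Proof. by apply/matrixP => a b; rewrite !mxE /= if_same. Qed.

Lemma coefmxP A B : (forall j, coefmx A j = coefmx B j) -> A = B.
Proof.
move=> AB; apply/matrixP => a b; apply: laurentP => j.
by have /matrixP/(_ a b) := AB j; rewrite !mxE.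
Qed.

Lemma lcoef_sum (I : Type) (r : seq I) (f : I -> F) j :
  (\sum_(i <- r) f i) j = \sum_(i <- r) f i j.
Proof. by apply: (big_morph (fun g : F => g j)) => //=; rewrite if_same. Qed.

Lemma coefmx_mul p q (r : nat) A B :
  (forall j, j < p -> coefmx A j = 0) -> (forall j, j < q -> coefmx B j = 0) ->
  coefmx (A * B) (p + q + r%:Z) =
    \sum_(i < r.+1) coefmx A (p + i%:Z) * coefmx B (q + (r - i)%:Z).
Proof.
move=> hA hB; apply/matrixP => a b; rewrite mxE mxE lcoef_sum summxE.
under [RHS]eq_bigr do rewrite mxE.
rewrite exchange_big; apply: eq_bigr => c _ /=.
rewrite (@conv_shift _ _ _ p q) => [|j jp|j jq].
- by apply: eq_bigr => i _; rewrite !mxE.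
- by have /matrixP/(_ a c) := hA j jp; rewrite !mxE.
- by have /matrixP/(_ c b) := hB j jq; rewrite !mxE.
Qed.

Lemma coefmx_mul_low p q j A B :
  (forall j, j < p -> coefmx A j = 0) -> (forall j, j < q -> coefmx B j = 0) ->
  j < p + q -> coefmx (A * B) j = 0.
Proof.
move=> hA hB jpq; apply/matrixP => a b; rewrite mxE mxE lcoef_sum mxE big1 // => c _.
apply: conv_low jpq => i ip.
  by have /matrixP/(_ a c) := hA i ip; rewrite !mxE.
by have /matrixP/(_ c b) := hB i ip; rewrite !mxE.
Qed.

(** For a subspace S this is t^p S[[t]], tested coefficient by coefficient in place of a tensor
    product. *)
Definition mxseries S p A :=
  forall j, S (coefmx A j) /\ (j < p -> coefmx A j = 0).

Lemma mxseries_sub S S' p q A : (forall X, S X -> S' X) -> q <= p ->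
  mxseries S p A -> mxseries S' q A.
Proof.
move=> SS' qp hA j; have [SA A0] := hA j; split; first exact: SS'.
by move=> jq; apply: A0; apply: lt_le_trans qp.
Qed.

Lemma mxseriesD S p A B : subspace S ->
  mxseries S p A -> mxseries S p B -> mxseries S p (A + B).
Proof.
move=> hS hA hB j; have [[SA A0] [SB B0]] := (hA j, hB j); rewrite coefmxD.
by split=> [|jp]; [exact: subspaceD|rewrite A0 // B0 // addr0].
Qed.

Lemma mxseriesN S p A : subspace S -> mxseries S p A -> mxseries S p (- A).
Proof.
move=> hS hA j; have [SA A0] := hA j; rewrite coefmxN.
by split=> [|jp]; [exact: subspaceN|rewrite A0 // oppr0].
Qed.

Lemma mxseriesZ S p c A : subspace S -> mxseries S p A -> mxseries S p (iota c *: A).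
Proof.
move=> hS hA j; have [SA A0] := hA j; rewrite coefmxZ.
by split=> [|jp]; [exact: subspaceZ|rewrite A0 // scaler0].
Qed.

Lemma mxseries0 S p : subspace S -> mxseries S p 0.
Proof. by case=> S0 _ j; rewrite coefmx0. Qed.

Lemma mxseries_sum S p (I : Type) (r : seq I) (f : I -> 'M[F]_n.+1) : subspace S ->
  (forall i, mxseries S p (f i)) -> mxseries S p (\sum_(i <- r) f i).
Proof.
move=> hS hf; elim/big_ind: (\sum_(i <- r) _) => //; first exact: mxseries0.
by move=> A B; apply: mxseriesD.
Qed.

Lemma mxseries_bracket S1 S2 S p q A B : subspace S ->
  (forall X Y, S1 X -> S2 Y -> S (X * Y - Y * X)) ->
  mxseries S1 p A -> mxseries S2 q B -> mxseries S (p + q) (A * B - B * A).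
Proof.
move=> hS SXY hA hB j; rewrite coefmxD coefmxN.
have A0 i : i < p -> coefmx A i = 0 by case: (hA i).
have B0 i : i < q -> coefmx B i = 0 by case: (hB i).
have [jpq|/int_split[r ->]] := ltP j (p + q).
  have jqp : j < q + p by rewrite addrC.
  rewrite (coefmx_mul_low A0 B0 jpq) (coefmx_mul_low B0 A0 jqp) subrr.
  by split=> //; case: hS.
split; last by lia.
rewrite (coefmx_mul _ A0 B0) addrC [p + q]addrC (coefmx_mul _ B0 A0).
(* S is known to contain commutators only, so one sum is reversed to match each product with its
   opposite. *)
rewrite [X in - X + _](reindex_inj rev_ord_inj) -sumrN -big_split /=.
apply: subspace_sum => // i; rewrite addrC.
have -> : (r - (r.+1 - i.+1) = i)%N by have := ltn_ord i; lia.
have -> : (r.+1 - i.+1 = r - i)%N by lia.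
by apply: SXY; [case: (hA (p + i%:Z))|case: (hB (q + (r - i)%:Z))].
Qed.

Fact lint_subproof (f : F) : bounded_below (fun j => f (j - 1) / j%:~R).
Proof.
have [p hp] := lcoefP f; exists p => j jp.
by rewrite hp ?mul0r //; lia.
Qed.
(* The term of exponent -1 is lost: its image is f_{-1} / 0 = 0. *)
Definition lint (f : F) : F := Laurent (lint_subproof f).

(** In characteristic 0 only t^-1 lacks a primitive, and 0 <= p excludes it. *)
Lemma mxseries_int S p A : subspace S -> 0 <= p -> mxseries S p A ->
  exists2 B, mxderiv B = A & mxseries S (p + 1) B.
Proof.
move=> hS p0 hA; exists (map_mx lint A).
  apply: coefmxP => j; apply/matrixP => a b; rewrite !mxE /= addrK.
  have [j0|j0] := eqVneq (j + 1) 0.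
    have [_ /(_ _)/matrixP/(_ a b)] := hA j; rewrite !mxE j0 mulr0z => -> //; lia.
  by rewrite -mulrzr divfK // intr_neq0.
move=> j; have -> : coefmx (map_mx lint A) j = j%:~R^-1 *: coefmx A (j - 1).
  by apply/matrixP => a b; rewrite !mxE /= mulrC.
have [SA A0] := hA (j - 1); split=> [|jp]; first exact: subspaceZ.
by rewrite A0 ?scaler0 //; lia.
Qed.

Local Notation exp := (expm iota).

(* gauge x A = A + delta(x) x^-1 for the derivation delta = d/dt - [A, -]. *)
Lemma gauge_exp A X (q : nat) : X ^+ n.+1 = 0 ->
  let W := mxderiv X + (X * A - A * X) in
  let ad Z := X * Z - Z * X in
  iter q ad W = 0 ->
  gauge (exp X) A = A + \sum_(j < q) iota (j.+1`!%:R)^-1 *: iter j ad W.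
Proof.
move=> X0 W ad adW.
pose delta Z := mxderiv Z + (Z * A - A * Z).
have delta_additive : zmod_morphism delta.
  move=> u v; rewrite /delta /mxderiv map_mxB mulrBl mulrBr [in RHS]opprD [RHS]addrACA.
  by congr (_ + _); rewrite !opprD !opprK addrACA.
pose deltaM := GRing.isZmodMorphism.Build _ _ delta delta_additive.
pose d : {additive _ -> _} := HB.pack delta deltaM.
have dM u v : d (u * v) = d u * v + u * d v.
  rewrite /= /delta mxderivM mulrDl mulrDr [RHS]addrACA; congr (_ + _).
  by rewrite mulrBl mulrBr !mulrA [RHS]addrC addrA subrK.
have dZ c u : d (iota c *: u) = iota c *: d u.
  rewrite /= /delta scalerDr -scalerAl -scalerAr -scalerBr; congr (_ + _).
  by apply/matrixP => i j; rewrite !mxE !in_algM lderivZ.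
have := delta_expm charK dM dZ (exprS_eq0 X0) adW.
have expE : exp X = \sum_(r < n.+2) iota (r`!%:R)^-1 *: X ^+ r.
  rewrite /expm (mxev_sum _ _ (size_poly _ _)); apply: eq_bigr => r _.
  by rewrite coef_poly ltn_ord.
rewrite -expE => dE.
have XV := expmN charK iota X0.
have [x_unit _] := mulmx1_unit XV.
have -> : gauge (exp X) A = A + d (exp X) * invmx (exp X).
  rewrite /gauge /= /delta mulrDl mulrBl -[X in X + _]mulrA.
  rewrite -[A * exp X * _]mulrA [exp X * invmx _](mulmxV x_unit) mulr1.
  by rewrite addrCA [A + _]addrC subrK addrC mulrA.
by rewrite dE -mulrA [exp X * invmx _](mulmxV x_unit) mulr1.
Qed.

End LaurentMatrices.

(** * Gauge transformations *)

Lemma map_mx_exp (R S : comNzRingType) (n : nat) (phi : {rmorphism R -> S})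
  (A : 'M[R]_n.+1) r : map_mx phi (A ^+ r) = map_mx phi A ^+ r.
Proof. exact: rmorphXn. Qed.

(** * Points of U over power series and Laurent series *)

Section Points.
Variables (K : closedFieldType) (n : nat) (U : 'M[K]_n.+1 -> Prop).
Hypothesis charK : [pchar K] =i pred0.
Hypothesis unipU : unipotent_group U.
Local Notation F := (laurent K).
Local Notation iota := (in_alg F : {rmorphism K -> F}).
Local Notation logset := (logset U).
Local Notation lie_central := (lie_central U).
Local Notation exp := (expm iota).

(* An equation satisfied by all elements of U(K) then holds at x. *)
Definition specialization (x : 'M[F]_n.+1) :=
  exists (r : nat) (G : 'M[{mpoly K[r]}]_n.+1) (c : 'I_r -> F),
    (forall a, U (map_mx (meval a) G)) /\ x = map_mx (mmap iota c) G.

(** Composing f with [G] gives a polynomial vanishing on all of K^r, hence also at the parameters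
    [c] in K((t)). *)
Lemma specialization_vanish x f : specialization x -> vanishing_ideal U f ->
  mmap iota (fun l => mxvec x 0 l) f = 0.
Proof.
move=> [r [G [c [GU ->]]]] fU.
transitivity (mmap iota c (mmap (@mpolyC r K) (fun l => mxvec G 0 l) f)).
  by rewrite mmap_comp; apply: eq_mmap => // l; rewrite -map_mxvec mxE.
apply: mmap_eq0 => // a; rewrite -(fU _ (GU a)).
rewrite /meval (mmap_comp (idfun : {rmorphism K -> K})).
by apply: eq_mmap => // l; rewrite -map_mxvec mxE.
Qed.

(** The variables of the two factors are made disjoint, so that each keeps its own parameters. *)
Lemma specializationM x y :
  specialization x -> specialization y -> specialization (x * y).
Proof.
move=> [r [G [c [GU ->]]]] [s [H [d [HU ->]]]].
have [[_ _ UM _ _] _] := unipU.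
pose incl u (h : 'I_u -> 'I_(r + s)) : {mpoly K[u]} -> {mpoly K[r + s]} :=
  mmap (@mpolyC (r + s) K) (fun i => 'X_(h i)).
have inclE (S : comNzRingType) (nu : {rmorphism K -> S}) u (h : 'I_u -> 'I_(r + s)) e
    (Q : 'M[{mpoly K[u]}]_n.+1) :
    map_mx (mmap nu e) (map_mx (incl u h) Q) = map_mx (mmap nu (e \o h)) Q.
  apply/matrixP => i j; rewrite !mxE /incl mmap_comp.
  by apply: eq_mmap => // l; rewrite mmapX mmap1U.
exists (r + s)%N, (map_mx (incl r (@lshift r s)) G * map_mx (incl s (@rshift r s)) H).
pose cd i := match split i with inl j => c j | inr j => d j end.
exists cd; split=> [a|].
  rewrite map_mxM /= /meval !(inclE _ (idfun : {rmorphism K -> K})).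
  by apply: UM; [apply: GU|apply: HU].
have cE : map_mx (mmap iota c) G = map_mx (mmap iota (cd \o @lshift r s)) G.
  apply: eq_map_mx => p; apply: eq_mmap => // l.
  by rewrite /cd /= (unsplitK (inl l)).
have dE : map_mx (mmap iota d) H = map_mx (mmap iota (cd \o @rshift r s)) H.
  apply: eq_map_mx => p; apply: eq_mmap => // l.
  by rewrite /cd /= (unsplitK (inr l)).
by rewrite cE dE -!inclE [RHS]map_mxM.
Qed.

(** [Gen] is the generic element of the Lie algebra: free coordinates pushed through the projector
    [P]. Since [P] fixes every coefficient of X, X is [Gen] at its own entries, and its nilpotency
    is an identity inherited from K-points. *)
Lemma specialization_exp X : (forall j, logset (coefmx X j)) ->
  X ^+ n.+1 = 0 /\ specialization (exp X).
Proof.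
move=> hX; have [P [SP hP]] := subspace_mx_fixed (logset_subspace charK unipU).
pose q := (n.+1 * n.+1)%N.
pose mpC : {rmorphism K -> _} := @mpolyC q K.
pose Gen : 'M[{mpoly K[q]}]_n.+1 := vec_mx ((\row_l 'X_l) *m map_mx mpC P).
have GenE (S : comNzRingType) (nu : {rmorphism K -> S}) (e : 'I_q -> S) :
    map_mx (mmap nu e) Gen = vec_mx ((\row_l e l) *m map_mx nu P).
  rewrite map_vec_mx map_mxM /= ; congr (vec_mx (_ *m _)).
    by apply/rowP => l; rewrite !mxE mmapX mmap1U.
  by apply/matrixP => i j; rewrite !mxE /= mmapC.
have GenK a : logset (map_mx (meval a) Gen).
  rewrite /meval (GenE _ (idfun : {rmorphism K -> K})).
  by rewrite (_ : map_mx idfun P = P) //; apply/matrixP => i j; rewrite mxE.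
pose c l := mxvec X 0 l.
have XE : X = map_mx (mmap iota c) Gen.
  apply: (can_inj mxvecK); rewrite GenE vec_mxK; apply/rowP => l; apply: laurentP => j.
  have /hP/rowP/(_ l) := hX j; rewrite /coefmx -map_mxvec mxE [in RHS]mxE => <-.
  rewrite mxE lcoef_sum; apply: eq_bigr => i _.
  by rewrite [in RHS]mulrC !mxE in_algM /= mulrC.
split.
  rewrite XE -map_mx_exp; apply/matrixP => i j; rewrite !mxE.
  apply: mmap_eq0 => // a; have [/matrixP/(_ i j)] := GenK a.
  by rewrite -map_mx_exp !mxE.
exists q, (expm mpC Gen), c; split=> [a|].
  rewrite (map_mxev _ _ (iota' := (idfun : {rmorphism K -> K}))) => [|b].
    by case: (GenK a).
  by rewrite /= mevalC.
by rewrite (map_mxev _ _ (iota' := iota)) -?XE // => b; rewrite /= mmapC.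
Qed.

Local Notation O := (powser K).
Implicit Types x y : 'M[O]_n.+1.

Lemma of_powserM x y : of_powser (x * y) = of_powser x * of_powser y.
Proof. exact: map_mxM. Qed.
Lemma of_powser1 : of_powser (1 : 'M[O]_n.+1) = 1.
Proof. exact: map_mx1. Qed.

Lemma of_powser_low x j : j < 0 -> coefmx (of_powser x) j = 0.
Proof.
by move=> j0; apply/matrixP => a b; rewrite !mxE; have /integralP := psvalP (x a b); apply.
Qed.

Lemma of_powser_ex (X : 'M[F]_n.+1) : (forall j, j < 0 -> coefmx X j = 0) ->
  exists x, of_powser x = X.
Proof.
move=> hX; exists (map_mx (insubd (0 : O)) X); apply/matrixP => a b; rewrite !mxE.
rewrite insubdK //; apply/integralP => j j0.
by have /matrixP/(_ a b) := hX j j0; rewrite !mxE.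
Qed.

Lemma val_in_alg c : val (in_alg O c) = in_alg F c.
Proof. exact: linearZ. Qed.

Lemma of_powser_exp (x : 'M[O]_n.+1) :
  of_powser (expm (in_alg O) x) = exp (of_powser x).
Proof. exact: map_mxev val_in_alg. Qed.

(** Invertibility over K[[t]] with specialization over K((t)) yields points over both rings and is
    stable under products. *)
Definition upoint x :=
  (exists y, x * y = 1 /\ y * x = 1) /\ specialization (of_powser x).

Lemma upoint1 : upoint 1.
Proof.
split; first by exists 1; rewrite mulr1.
exists 0%N, 1, (fun=> 0); split=> [a|]; last by rewrite of_powser1 map_mx1.
by rewrite map_mx1; case: unipU => -[].
Qed.

Lemma upointM x y : upoint x -> upoint y -> upoint (x * y).
Proof.
move=> [[x' [xx' x'x]] sx] [[y' [yy' y'y]] sy]; split.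
  exists (y' * x'); rewrite !mulrA -(mulrA x) yy' mulr1 xx'.
  by rewrite -(mulrA y') x'x mulr1.
by rewrite of_powserM; apply: specializationM.
Qed.

Lemma upoint_unit x : upoint x -> of_powser x \in unitmx.
Proof.
move=> [[y [xy _]] _]; have := congr1 (@of_powser K n.+1) xy.
by rewrite of_powserM of_powser1 => /mulmx1_unit[].
Qed.

Lemma upoint_points x : upoint x -> points U x.
Proof.
move=> [ux sx]; split=> // f fU; apply: val_inj.
rewrite [LHS]rmorph_mmap -[RHS](specialization_vanish sx fU).
apply: eq_mmap => [c|l]; first exact: val_in_alg.
by rewrite /= /of_powser -map_mxvec mxE.
Qed.

Lemma upoint_points_laurent x : upoint x -> points U (of_powser x).
Proof.
move=> [[y [xy yx]] sx]; split; last by move=> f; apply: specialization_vanish.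
exists (of_powser y); split.
  by rewrite -[LHS]of_powserM xy of_powser1.
by rewrite -[LHS]of_powserM yx of_powser1.
Qed.

Definition congruent1 (e : int) x :=
  forall j, j < e -> coefmx (of_powser x - 1) j = 0.

Lemma congruent1P e x : congruent1 e x -> cong1 e x.
Proof.
move=> hx; pose Z := lvar K ^ (- e) *: (of_powser x - 1).
have [y yZ] : exists y, of_powser y = Z.
  apply: of_powser_ex => j j0; apply/matrixP => a b; rewrite !mxE lvarXM opprK.
  have je : j + e < e by lia.
  by have /matrixP/(_ a b) := hx _ je; rewrite !mxE.
exists y; rewrite yZ scalerA -expfzDr ?lvar_neq0 // subrr expr0z scale1r.
by [].
Qed.

Lemma congruent1M e x y : congruent1 e x -> congruent1 e y -> congruent1 e (x * y).
Proof.
move=> hx hy j je; rewrite of_powserM.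
have -> : of_powser x * of_powser y - 1 =
    (of_powser x - 1) * of_powser y + (of_powser y - 1).
  by rewrite mulrBl mul1r addrA subrK.
rewrite coefmxD hy // addr0.
by apply: (coefmx_mul_low hx (of_powser_low y)); rewrite addr0.
Qed.

(** * The gauge action and successive approximation *)

Lemma gaugeM (x y A : 'M[F]_n.+1) : x \in unitmx -> y \in unitmx ->
  gauge (x * y) A = gauge x (gauge y A).
Proof.
move=> ux uy.
have invM : invmx (x * y) = invmx y * invmx x.
  have xV : x * invmx x = 1 by apply: mulmxV.
  have yV : y * invmx y = 1 by apply: mulmxV.
  have xyV : (x * y) * (invmx y * invmx x) = 1.
    by rewrite !mulrA -(mulrA x) yV mulr1.
  have Vxy : invmx (x * y) * (x * y) = 1.
    by apply: mulVmx; rewrite unitmx_mul ux.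
  by rewrite -[LHS]mulr1 -xyV mulrA Vxy mul1r.
have yV : y * invmx y = 1 by apply: mulmxV.
change (x * y * A * invmx (x * y) + mxderiv (x * y) * invmx (x * y) =
  x * (y * A * invmx y + mxderiv y * invmx y) * invmx x + mxderiv x * invmx x).
rewrite invM mxderivM mulrDl mulrDr mulrDl !mulrA -(mulrA (mxderiv x)) yV mulr1.
by rewrite -addrA [X in _ + X]addrC.
Qed.

Lemma gauge1 (A : 'M[F]_n.+1) : gauge 1 A = A.
Proof.
change (1 * A * invmx 1 + mxderiv 1 * invmx 1 = A).
have D1 : mxderiv (1 : 'M[F]_n.+1) = 0.
  apply: (addrI (mxderiv 1)); rewrite addr0.
  by rewrite -{3}[1](mulr1 1) mxderivM mulr1 mul1r.
by rewrite D1 mul0r addr0 mul1r invmx1; apply: mulmx1.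
Qed.

(** For an integral X of D, the terms of [gauge_exp] beyond A + D are [X, A] and iterated brackets
    of W = D + [X, A] with X. Every bracket lowers the central index by one. X has order at least k
    + 1 and A at least -a, so [X, A] has order at least k + 1 - a; as 1 <= a, so does D, and further
    brackets with X only raise it. *)
Lemma gauge_step i (a k : int) A D : 1 <= a -> 0 <= k ->
  mxseries logset (- a) A -> mxseries (lie_central i.+1) k D ->
  exists x, [/\ upoint x, congruent1 (k + 1) x &
    mxseries (lie_central i) (k + 1 - a) (gauge (of_powser x) A - A - D)].
Proof.
move=> a1 k0 hA hD.
have subV := logset_subspace charK unipU.
have subC := lie_central_subspace charK unipU.
have CV := lie_central_logset charK unipU.
have [X XD hX] := mxseries_int charK (subC i.+1) k0 hD.
have X_log j : logset (coefmx X j) by case: (hX j) => /CV.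
have [X0 sX] := specialization_exp X_log.
have [xi xiX] : exists xi, of_powser xi = X.
  by apply: of_powser_ex => j j0; case: (hX j) => _; apply; lia.
have xi0 : xi ^+ n.+1 = 0.
  move: X0; rewrite -xiX -[LHS]map_mx_exp => /matrixP X0.
  by apply/matrixP => i0 j; apply: val_inj; have := X0 i0 j; rewrite !mxE.
exists (expm (in_alg O) xi); split.
- split; last by rewrite of_powser_exp xiX.
  by exists (expm (in_alg O) (- xi)); rewrite expmN ?expmNl.
- move=> j jk; rewrite /expm texp_expand mxevD mxev1 mxevM mxevX.
  set E1 := mxev _ _ xi.
  rewrite (_ : of_powser _ = 1 + X * of_powser E1); last first.
    by rewrite -xiX -of_powserM -of_powser1 /of_powser map_mxD.
  rewrite addrC addKr; apply: (coefmx_mul_low _ (of_powser_low E1)).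
    by move=> l lk; case: (hX l) => _; apply; exact: lk.
  by rewrite addr0.
rewrite of_powser_exp xiX.
pose W := mxderiv X + (X * A - A * X); pose ad Z := X * Z - Z * X.
have XA : mxseries (lie_central i) (k + 1 - a) (X * A - A * X).
  by apply: mxseries_bracket hX hA => // Y Z [_]; apply.
have hW : mxseries (lie_central i.+1) (k + 1 - a) W.
  apply: mxseriesD => //.
    by rewrite XD; apply: mxseries_sub hD => //; lia.
  by apply: mxseries_sub XA => // Y; apply: (lie_centralS charK unipU).
have adW j : (j <= i.+1)%N -> mxseries (lie_central (i.+1 - j)) (k + 1 - a) (iter j ad W).
  elim: j => [|j IHj] ji; first by rewrite subn0.
  have {}IHj := IHj (ltnW ji).
  (* The sign puts the central element on the left, as in [lie_central]. *)
  have -> : iter j.+1 ad W = - (iter j ad W * X - X * iter j ad W).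
    by rewrite opprB.
  apply: mxseriesN => //.
  apply: (@mxseries_sub _ _ (lie_central (i.+1 - j.+1)) _ (k + 1 - a + (k + 1))) => //.
    by lia.
  apply: mxseries_bracket IHj hX => // Y Z.
  by rewrite -(subnSK ji) => -[_ cY] /CV; apply: cY.
have adi : iter i.+1 ad W = 0.
  apply: coefmxP => j; rewrite coefmx0.
  by have := adW i.+1 (leqnn _); rewrite subnn => /(_ j)[].
have lower j r : (r <= j)%N -> forall Y, lie_central r Y -> lie_central j Y.
  move=> /subnKC <- Y; elim: (j - r)%N => [|d IHd] hY; first by rewrite addn0.
  by rewrite addnS; apply: (lie_centralS charK unipU); apply: IHd.
have -> : gauge (exp X) A - A - D =
    X * A - A * X + \sum_(j < i) iota (j.+2`!%:R)^-1 *: iter j.+1 ad W.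
  rewrite (gauge_exp charK X0 adi) big_ord_recl factS fact0 muln1 invr1.
  rewrite rmorph1 scale1r [A + _]addrC addrK -/W {1}/W XD.
  by rewrite -[D + _ + _]addrA [D + _]addrC addrK.
apply: mxseriesD => //; apply: mxseries_sum => // j; apply: mxseriesZ => //.
have ji : (j.+1 <= i.+1)%N by rewrite ltnS ltnW.
apply: mxseries_sub (adW j.+1 ji) => //.
by apply: lower; rewrite subSS leq_subr.
Qed.

(** The bound on e is set by the last of the i steps, which starts at order k - (i - 1)(a - 1).
    Together with 1 <= e it keeps the order nonnegative at every step. *)
Lemma gauge_solve (i : nat) (a e : int) : 1 <= a -> 1 <= e ->
  forall A B k, mxseries logset (- a) A -> mxseries (lie_central i) k (B - A) ->
  e <= k + 1 - (i%:Z - 1) * (a - 1) ->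
  exists x, [/\ upoint x, congruent1 e x & gauge (of_powser x) A = B].
Proof.
move=> a1 e1; have subV := logset_subspace charK unipU.
elim: i => [|i IHi] A B k hA hBA ek.
  exists 1; split; first exact: upoint1.
    by move=> j _; rewrite of_powser1 subrr coefmx0.
  rewrite of_powser1 gauge1; apply/eqP; rewrite eq_sym -subr_eq0; apply/eqP.
  by apply: coefmxP => j; rewrite coefmx0; case: (hBA j).
have ia : 0 <= i%:Z * (a - 1) by apply: mulr_ge0; lia.
have k0 : 0 <= k by lia.
have [x [ux cx hx]] := gauge_step a1 k0 hA hBA.
(* The same a serves in the next step: the change has order at least k + 1 - a, above -a. *)
have hA' : mxseries logset (- a) (gauge (of_powser x) A).
  have -> : gauge (of_powser x) A = A + (B - A) + (gauge (of_powser x) A - A - (B - A)).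
    by rewrite [in RHS]addrC -[_ - A - _]addrA -opprD subrK.
  apply: mxseriesD => //; first apply: mxseriesD => //.
    by apply: mxseries_sub hBA; [exact: lie_central_logset|lia].
  by apply: mxseries_sub hx; [exact: lie_central_logset|lia].
have hB : mxseries (lie_central i) (k + 1 - a) (B - gauge (of_powser x) A).
  have -> : B - gauge (of_powser x) A = - (gauge (of_powser x) A - A - (B - A)).
    by rewrite opprB opprB addrA subrK.
  by apply: mxseriesN => //; apply: lie_central_subspace.
have [|y [uy cy yB]] := IHi _ _ _ hA' hB; first by nia.
exists (y * x); split; first exact: upointM.
  apply: congruent1M => // j je; apply: cx; lia.
by rewrite of_powserM gaugeM ?upoint_unit.
Qed.

Lemma connection_logset A : connection U A -> forall j, logset (coefmx A j).
Proof.
move=> [r [c [X [hX ->]]]] j.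
have -> : coefmx (\sum_(i < r) c i *: map_mx (in_alg F) (X i)) j =
    \sum_(i < r) c i j *: X i.
  apply/matrixP => a b; rewrite !mxE summxE lcoef_sum summxE.
  by apply: eq_bigr => i _; rewrite !mxE mulrC in_algM /= mulrC.
apply: subspace_sum => [|i]; first exact: logset_subspace.
by apply: subspaceZ; [exact: logset_subspace|exact: lie_algebra_logset].
Qed.

Lemma connection_series A p : connection U A ->
  (forall j, j < p -> coefmx A j = 0) -> mxseries logset p A.
Proof. by move=> cA A0 j; split; [exact: connection_logset|exact: A0]. Qed.

Lemma connection_cong_low e (A B : 'M[F]_n.+1) : connection_cong U e B A ->
  forall j, j < e -> coefmx (B - A) j = 0.
Proof.
move=> [C _ ->] j je; apply/matrixP => a b; rewrite !mxE lvarXM.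
have je' : j - e < 0 by lia.
by have /matrixP/(_ a b) := of_powser_low C je'; rewrite !mxE.
Qed.

Lemma connection_zero : connection U 0.
Proof.
by exists 0%N, (fun=> 0), (fun=> 0); split=> [[]//|]; rewrite big_ord0.
Qed.

Lemma gauge_solve_connection (c : nat) (a k e : int) A B :
  nilpotency_class U c -> 1 <= a -> 1 <= e -> e <= k + 1 - c%:Z * (a - 1) ->
  connection U A -> connection U B ->
  (forall j, j < - a -> coefmx A j = 0) ->
  (forall j, j < k -> coefmx (B - A) j = 0) ->
  exists x, [/\ upoint x, congruent1 e x & gauge (of_powser x) A = B].
Proof.
move=> [Uc _] a1 e1 ek cA cB A0 BA0.
have hA := connection_series cA A0.
(* Class c makes term c + 1 of the central series everything, so i - 1 is c in the bound on e. *)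
apply: (gauge_solve (i := c.+1) (k := k) a1 e1 hA); last by lia.
move=> j; split; last exact: BA0.
apply: (lie_central_full charK unipU Uc); rewrite coefmxD coefmxN.
by apply: subspaceB (logset_subspace charK unipU) _ _; apply: connection_logset.
Qed.

End Points.

Theorem proposition3p25 (K : closedFieldType) (charK : [pchar K] =i pred0)
    (N : nat) (U : 'M[K]_N -> Prop) (unipU : unipotent_group U)
    (n : nat) (classU : nilpotency_class U n)
    (m : int) (A : 'M[laurent K]_N) (connA : connection U A)
    (A_low : forall j : int, j < m -> coefmx A j = 0)
    (A_lead : coefmx A m <> 0) :
  (-1 < m ->
    exists x : 'M[powser K]_N,
      [/\ points U x, cong1 (m + 1) x & gauge (of_powser x) A = 0]) /\
  (m <= -1 ->
    (forall B : 'M[laurent K]_N, connection U B ->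
       (forall j : int, j < m -> coefmx B j = 0) ->
       (forall j : int, m <= j < n%:Z * (`|m| - 1) -> coefmx B j = coefmx A j) ->
       gauge_equivalent U A B) /\
    (forall (B : 'M[laurent K]_N) (k : int), connection U B ->
       n%:Z * (`|m| - 1) <= k -> connection_cong U k B A ->
       exists x : 'M[powser K]_N,
         [/\ points U x, cong1 (k - n%:Z * `|m| + n%:Z + 1) x
           & gauge (of_powser x) A = B])).
Proof.
case: N => [|N] in U unipU classU A connA A_low A_lead *.
  by case: A_lead; apply/matrixP => -[].
split=> [m0|m1].
  (* Target 0 and k = m. The pole bound a = 1 costs no order, so every step is 1 modulo t^(m +
     1). *)
  have [|||||j jm|j jm|x [ux cx xA]] :=
    @gauge_solve_connection K N U charK unipU n 1 m (m + 1) A 0 classU.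
  - by [].
  - by lia.
  - by lia.
  - exact: connA.
  - exact: connection_zero.
  - by apply: A_low; lia.
  - by rewrite sub0r coefmxN A_low ?oppr0.
  by exists x; split; [exact: upoint_points|exact: congruent1P|].
have solve B k : connection U B -> n%:Z * (`|m| - 1) <= k ->
    (forall j, j < k -> coefmx (B - A) j = 0) ->
    exists x, [/\ upoint U x, congruent1 (k - n%:Z * `|m| + n%:Z + 1) x
      & gauge (of_powser x) A = B].
  move=> cB nk BA0.
  have nm : n%:Z * (`|m| - 1) = n%:Z * `|m| - n%:Z by rewrite mulrBr mulr1.
  apply: (@gauge_solve_connection K N U charK unipU n `|m| k) => //; try lia.
  by move=> j jm; apply: A_low; lia.
split=> [B cB B_low BA|B k cB nk cBA]; last first.
  have [x [ux cx xA]] := solve B k cB nk (connection_cong_low cBA).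
  by exists x; split; [exact: upoint_points|exact: congruent1P|].
(* The least admissible k, namely n(|m| - 1); below m both connections have zero coefficients. *)
have [|x [ux _ xA]] := solve B _ cB (lexx _).
  move=> j jn; rewrite coefmxD coefmxN; have [jm|mj] := ltP j m.
    by rewrite B_low // A_low // subrr.
  by rewrite BA ?mj // subrr.
by exists (of_powser x); [exact: upoint_points_laurent|].
Qed.
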